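(* There is an absolute constant $C>0$ such that for every orthonormal system $\Phi=\{\phi_n\}_{n\in\mathbb{N}}$ on $\mathbb{T}$ and every $f\in L^2(\mathbb{T})$ with $a_n=\langle f,\phi_n\rangle$, $$\|S[f]\|_{L^2(V^2)}\le C\left(\sum_{n=1}^{\infty}|a_n|^2\ln^2(n+1)\right)^{1/2}.$$ Moreover, let $\Delta:\mathbb{N}\to\mathbb{R}$ be a function and suppose there is a constant $A>0$ such that $\|\mathcal{M}f\|_{L^2}\le A\,\Delta(N)\|f\|_{L^2}$ for all $N\in\mathbb{N}$ and all $f=\sum_{n=1}^{N}a_n\phi_n$. Then there is a constant $C'>0$ depending only on $A$ such that for all $N\in\mathbb{N}$ and all $f=\sum_{n=1}^{N}a_n\phi_n$, $$\|S[f]\|_{L^2(V^2)}\le C'\left(\sum_{n=1}^{N}\Delta(n)^2\ln(n+1)\,|a_n|^2\right)^{1/2}.$$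
   Context: $\mathbb{T}=[0,1]$ with Lebesgue measure. An orthonormal system (ONS) is an ordered sequence $\{\phi_n\}_{n\in\mathbb{N}}$ of real or complex valued functions orthonormal in $L^2(\mathbb{T})$. The maximal partial sum operator is $\mathcal{M}f(x)=\sup_{N}\left|\sum_{n=1}^{N}a_n\phi_n(x)\right|$ with $a_n=\langle f,\phi_n\rangle$. For a sequence $a=(a_n)$ of complex numbers and $1\le r<\infty$, $\|a\|_{V^r}=\lim_{K\to\infty}\sup_{\mathcal{P}_K}\left(\sum_{I\in\mathcal{P}_K}\left|\sum_{n\in I}a_n\right|^r\right)^{1/r}$, the supremum being over all partitions $\mathcal{P}_K$ of $[K]=\{1,\dots,K\}$ into disjoint subintervals; for a sequence of finite length $K$ the limit is dropped. $S[f](x)$ is the sequence $\{a_n\phi_n(x)\}_n$, $\|S[f]\|_{V^2}(x)$ is the $V^2$ norm of this sequence, and $\|S[f]\|_{L^2(V^2)}$ is the $L^2(\mathbb{T})$ norm of the function $x\mapsto\|S[f]\|_{V^2}(x)$. *)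

(* Defs.v *)
From mathcomp Require Import all_boot all_order all_algebra.
From mathcomp Require Import all_classical all_reals all_analysis.
From mathcomp.real_closed Require Import complex.

Set Implicit Arguments.
Unset Strict Implicit.
Unset Printing Implicit Defensive.

Import Order.TTheory GRing.Theory Num.Theory.
Import numFieldNormedType.Exports.

Local Open Scope classical_set_scope.
Local Open Scope ring_scope.

(* Sequences indexed by {1, 2, ...} are functions on [nat] whose value at 0 is
   never used.  The modulus of [z : R[i]] is [Normc.normc z : R].  Functions on
   [0,1] are functions on [R] whose values off [0,1] are never used. *)

Section VariationNorm.
Context {R : realType}.

(* [k : 'I_K] stands for the element k+1 of [K] = {1, ..., K}. *)
Definition is_subinterval (K : nat) (I : {set 'I_K}) : bool :=
  [exists i : 'I_K, exists j : 'I_K, I == [set k : 'I_K | (i <= k <= j)%N]%SET].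

Definition interval_partition (K : nat) (P : {set {set 'I_K}}) : bool :=
  finset.partition P [set: 'I_K]%SET && [forall I in P, is_subinterval I].

Definition Vnorm_fin (r : R) (K : nat) (a : nat -> R[i]) : R :=
  \big[Num.max/0]_(P : {set {set 'I_K}} | interval_partition P)
    ((\sum_(I in P) (Normc.normc (\sum_(k in I) a k.+1)) `^ r) `^ r^-1).

(* Nondecreasing limit in [\bar R], possibly [+oo]. *)
Definition Vnorm (r : R) (a : nat -> R[i]) : \bar R :=
  limn (fun K => (Vnorm_fin r K a)%:E).

End VariationNorm.

Section OrthonormalSystems.
Context {R : realType}.

Local Notation mu := (@lebesgue_measure R).
Local Notation T := (`[0%R, 1%R]%classic : set R).

Definition L2norm (g : R -> \bar R) : \bar R := ('N[mu]_2%:E [g \_ T])%E.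

Definition L2normC (f : R -> R[i]) : \bar R :=
  L2norm (fun x => (Normc.normc (f x))%:E).

Definition in_L2 (f : R -> R[i]) : Prop :=
  [/\ measurable_fun T (fun x => complex.Re (f x)),
      measurable_fun T (fun x => complex.Im (f x))
    & (L2normC f < +oo)%E].

Definition inner (f g : R -> R[i]) : R[i] :=
  let h := fun x => f x * conjc (g x) in
  Complex (\int[mu]_(x in T) complex.Re (h x))
          (\int[mu]_(x in T) complex.Im (h x)).

(* Real-valued systems are the case where all imaginary parts vanish. *)
Definition ONS (phi : nat -> R -> R[i]) : Prop :=
  (forall n, (0 < n)%N -> in_L2 (phi n)) /\
  (forall m n, (0 < m)%N -> (0 < n)%N -> inner (phi m) (phi n) = (m == n)%:R).

Definition coef (phi : nat -> R -> R[i]) (f : R -> R[i]) (n : nat) : R[i] :=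
  inner f (phi n).

Definition Sseq (phi : nat -> R -> R[i]) (f : R -> R[i]) (x : R) : nat -> R[i] :=
  fun n => coef phi f n * phi n x.

Definition maximal (phi : nat -> R -> R[i]) (f : R -> R[i]) (x : R) : \bar R :=
  ereal_sup [set (Normc.normc (\sum_(1 <= n < N.+1) Sseq phi f x n))%:E
            | N in [set N | (0 < N)%N]].

Definition L2Vnorm (r : R) (phi : nat -> R -> R[i]) (f : R -> R[i]) : \bar R :=
  L2norm (fun x => Vnorm r (Sseq phi f x)).

Definition lincomb (phi : nat -> R -> R[i]) (N : nat) (a : nat -> R[i]) :
    R -> R[i] :=
  fun x => \sum_(1 <= n < N.+1) a n * phi n x.

End OrthonormalSystems.

(* Main.v *)
Require Import Defs.
From mathcomp Require Import all_boot all_order all_algebra.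
From mathcomp Require Import all_classical all_reals all_analysis.
From mathcomp.real_closed Require Import complex.
From mathcomp Require Import measurable_realfun.
From mathcomp Require Import zify ring lra.
Import Order.TTheory GRing.Theory Num.Theory.
Import numFieldNormedType.Exports.
Local Open Scope classical_set_scope.
Local Open Scope ring_scope.

(** Both inequalities are proved for the squares: with [Q x] a pointwise bound
for the square of the variation of the terms [a_n phi_n(x)], one bounds the
integral of [Q].

First suppose that [a] is supported on [{0, ..., N}], with [N < 2^k] and [k]
comparable to [ln (N + 2)], and consider the dyadic intervals inside
[[0, 2^k)].

- An arbitrary orthonormal system.  An interval is the disjoint union of at most
  [2k + 1] maximal dyadic intervals, so by Cauchy-Schwarz its squared sum is at
  most [2k + 1] times the sum of the squared sums over these.  For disjoint
  intervals each dyadic interval is used at most once.  The squared sums over all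
  dyadic intervals integrate to [(k + 1) ||a||^2], one [||a||^2] for each scale,
  which gives [O(k^2) ||a||^2] ([var2_L2_le_log]).
- A maximal inequality with constant [D].  Stop at the first dyadic interval [J]
  whose midpoint splits the given interval: the sum is then at most twice the
  maximal prefix sum over [J], and [J] serves only one of several disjoint
  intervals.  The squares of these maximal functions integrate to [D^2 ||a||^2]
  for each scale, which gives [O(D^2 k) ||a||^2] ([var2_L2_le_max]).

In both cases the bound is [B * w N * ||a||^2] for a nondecreasing weight
[w >= 1].

To replace [w N] by [w n], cut the indices into the consecutive blocks on which
[2^m <= w n < 2^(m+1)].  An interval meets some blocks completely and at most two
partially.  The partial ones are controlled by the variations inside the blocks,
which cost [B 2^(m+1) ||a^m||^2] and hence at most [2 B] times the weighted sum.
For the complete ones, the variation is at most the sum of the moduli of the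
block sums [c_m], and since the [2^-m] are summable the square of this is at most
[2 sum_m 2^m |c_m|^2], whose integral is again at most the weighted sum
([var2_le_glue], [var2_L2_le_glue]).

The function [Delta] need not be monotone, but a linear combination of length [N]
is also one of every length [M >= N], so the maximal inequality holds with the
infimum of [A * Delta M] over [M >= N], which is nondecreasing, at most
[A * Delta N], and at least 1 because the maximal function of [phi_1] dominates
the modulus of [phi_1].

Monotone convergence along the finite variation norms concludes.  Indices start
at 0 below: [phi n.+1] and [a n.+1] play the role of the terms of index [n], and
intervals are half-open. *)

Set Implicit Arguments.
Unset Strict Implicit.
Unset Printing Implicit Defensive.

(** * Interval sums and families of disjoint intervals *)

Section Pointwise.
Context {R : realType}.
Implicit Types (a : nat -> R[i]) (q : R).
Local Notation nrm := (@Normc.normc R).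

Lemma normc_ge0 (z : R[i]) : 0 <= nrm z.
Proof. by case: z => x y; exact: sqrtr_ge0. Qed.

Lemma normc_zero : nrm 0 = 0. Proof. exact: Normc.normc0. Qed.

Lemma sqr_normcE (z : R[i]) : nrm z ^+ 2 = complex.Re z ^+ 2 + complex.Im z ^+ 2.
Proof. by case: z => x y /=; rewrite sqr_sqrtr ?addr_ge0 ?sqr_ge0. Qed.

Lemma normcD (x y : R[i]) : nrm (x + y) <= nrm x + nrm y.
Proof. exact: (@le_normcD R x y). Qed.

Lemma normc_sum (I : Type) (r : seq I) (P : pred I) (F : I -> R[i]) :
  nrm (\sum_(i <- r | P i) F i) <= \sum_(i <- r | P i) nrm (F i).
Proof.
elim/big_rec2: _ => [|i x y _ H]; first by rewrite normc_zero.
by apply: le_trans (normcD _ _) _; rewrite lerD2l.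
Qed.

(** Sum of [a] over the half-open interval [[i, j)]; it is 0 when [j <= i]. *)
Definition isum a i j := \sum_(i <= k < j) a k.

Lemma isum_cat a i m j : (i <= m)%N -> (m <= j)%N ->
  isum a i j = isum a i m + isum a m j.
Proof. by move=> im mj; rewrite /isum (big_cat_nat im mj). Qed.

(** Squared modulus of the interval sum. *)
Definition osc a i j : R := nrm (isum a i j) ^+ 2.

Lemma osc_ge0 a i j : 0 <= osc a i j. Proof. exact: sqr_ge0. Qed.

Lemma osc_geq a i j : (j <= i)%N -> osc a i j = 0.
Proof. by move=> ji; rewrite /osc /isum big_geq// normc_zero expr0n. Qed.

(** The intervals [[lo t, hi t)], for [t] satisfying [P], are pairwise disjoint:
every point lies in at most one of them. *)
Definition disjoint_family (T : finType) (P : pred T) (lo hi : T -> nat) :=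
  forall x, (\sum_(t | P t) (lo t <= x < hi t) <= 1)%N.

(** The square of the 2-variation of [a] is at most [q].  Families of disjoint
intervals replace partitions; no covering condition is needed since omitting
intervals only decreases the sum. *)
Definition var2_le a q : Prop :=
  forall (T : finType) (P : pred T) (lo hi : T -> nat),
    disjoint_family P lo hi -> \sum_(t | P t) osc a (lo t) (hi t) <= q.

Lemma disjoint_sum (T : finType) (P : pred T) (lo hi : T -> nat) x q :
  disjoint_family P lo hi -> 0 <= q ->
  \sum_(t | P t) (lo t <= x < hi t)%:R * q <= q.
Proof.
move=> /(_ x) dj q0; rewrite -mulr_suml -natr_sum.
by rewrite -[leRHS]mul1r ler_wpM2r// (ler_nat _ _ 1).
Qed.

(** ** Decomposition into maximal dyadic intervals *)

(** Sum of [osc a] over all dyadic subintervals of [[u, u + 2^k)]. *)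
Fixpoint dyadic_energy a k u : R :=
  if k is k'.+1 then
    osc a u (u + 2 ^ k) + (dyadic_energy a k' u + dyadic_energy a k' (u + 2 ^ k')%N)
  else osc a u u.+1.

(** Number of maximal dyadic subintervals of [[u, u + 2^k)] inside [[i, j)]. *)
Fixpoint cover_card k u i j : nat :=
  if ((i <= u) && (u + 2 ^ k <= j))%N then 1%N else
  if k is k'.+1 then (cover_card k' u i j + cover_card k' (u + 2 ^ k')%N i j)%N
  else 0%N.

(** Sum of [osc a] over those maximal dyadic subintervals. *)
Fixpoint cover_energy a k u i j : R :=
  if ((i <= u) && (u + 2 ^ k <= j))%N then osc a u (u + 2 ^ k) else
  if k is k'.+1 then cover_energy a k' u i j + cover_energy a k' (u + 2 ^ k')%N i j
  else 0.

Lemma cover_energy_ge0 a k u i j : 0 <= cover_energy a k u i j.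
Proof. by elim: k u => [|k IH] u /=; case: ifP; rewrite ?addr_ge0 ?osc_ge0. Qed.

Lemma cover_card_disjoint k u i j : (j <= u)%N || (u + 2 ^ k <= i)%N ->
  cover_card k u i j = 0%N.
Proof.
elim: k u => [|k IH] u /= H.
  by case: ifP => // /andP[]; rewrite expn0 in H *; lia.
have e0 := expn_gt0 2 k.
rewrite expnS in H *; case: ifP => [/andP[]|_]; first by lia.
by rewrite !IH//; lia.
Qed.

(** If [[i, j)] starts at or before [u], at each scale only one half can be cut, so
that there is at most one dyadic piece for each scale. *)
Lemma cover_card_prefix k u i j : (i <= u)%N -> (cover_card k u i j <= k.+1)%N.
Proof.
elim: k u => [|k IH] u /= iu; first by case: ifP.
case: ifP => // _.
case: (leqP (u + 2 ^ k) j) => H.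
  have -> : cover_card k u i j = 1%N by case: (k) H => [|k'] /= H; rewrite iu H.
  by rewrite add1n ltnS IH//; lia.
by rewrite [X in (_ + X)%N]cover_card_disjoint ?(ltnW H)// addn0 leqW// IH.
Qed.

Lemma cover_card_suffix k u i j : (u + 2 ^ k <= j)%N ->
  (cover_card k u i j <= k.+1)%N.
Proof.
elim: k u => [|k IH] u /= uj; first by case: ifP.
have e0 := expn_gt0 2 k.
case: ifP => // _; rewrite expnS in uj.
case: (leqP i (u + 2 ^ k)) => H.
  have -> : cover_card k (u + 2 ^ k) i j = 1%N.
    have uj' : (u + 2 ^ k + 2 ^ k <= j)%N by lia.
    by case: (k) H uj' => [|k'] /= H uj'; rewrite H uj'.
  by rewrite addn1 ltnS IH//; lia.
by rewrite cover_card_disjoint ?(ltnW H) ?orbT// add0n leqW// IH//; lia.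
Qed.

Lemma cover_card_le k u i j : (cover_card k u i j <= 2 * k + 1)%N.
Proof.
elim: k u => [|k IH] u /=; first by case: ifP.
case: ifP => [_|_]; first by lia.
case: (leqP j (u + 2 ^ k)) => H1.
  by rewrite [X in (_ + X)%N]cover_card_disjoint ?H1// addn0 (leq_trans (IH _))//; lia.
case: (leqP (u + 2 ^ k) i) => H2.
  by rewrite cover_card_disjoint ?H2 ?orbT// add0n (leq_trans (IH _))//; lia.
have := @cover_card_suffix k u i j (ltnW H1).
have := @cover_card_prefix k (u + 2 ^ k) i j (ltnW H2).
lia.
Qed.

(** Cauchy-Schwarz over the maximal dyadic subintervals of [[i, j)]. *)
Lemma osc_cover a k u i j : (i <= j)%N ->
  osc a (maxn i u) (minn j (u + 2 ^ k)) <=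
  (cover_card k u i j)%:R * cover_energy a k u i j.
Proof.
move=> ij; elim: k u => [|k IH] u /=.
  case: ifP => [/andP[iu uj]|H]; last by rewrite mul0r osc_geq//; lia.
  by rewrite mul1r (maxn_idPr iu) (minn_idPr uj).
case: ifP => [/andP[iu uj]|H].
  by rewrite mul1r (maxn_idPr iu) (minn_idPr uj).
have e0 := expn_gt0 2 k; rewrite expnS in H *.
case: (leqP j (u + 2 ^ k)) => H1.
  have -> : minn j (u + 2 * 2 ^ k) = minn j (u + 2 ^ k) by lia.
  apply: le_trans (IH u) _; rewrite ler_pM ?ler0n ?cover_energy_ge0//.
    by rewrite ler_nat leq_addr.
  by rewrite lerDl cover_energy_ge0.
case: (leqP (u + 2 ^ k) i) => H2.
  have -> : maxn i u = maxn i (u + 2 ^ k) by lia.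
  have -> : minn j (u + 2 * 2 ^ k) = minn j (u + 2 ^ k + 2 ^ k) by lia.
  apply: le_trans (IH _) _; rewrite ler_pM ?ler0n ?cover_energy_ge0//.
    by rewrite ler_nat leq_addl.
  by rewrite lerDr cover_energy_ge0.
move: (IH u) (IH (u + 2 ^ k)%N).
rewrite (minn_idPr (ltnW H1)) (maxn_idPr (ltnW H2)).
have -> : minn j (u + 2 * 2 ^ k) = minn j (u + 2 ^ k + 2 ^ k) by lia.
rewrite natrD.
set c1 := _%:R; set N1 := cover_energy _ _ _ _ _.
set c2 := (cover_card _ (_ + _)%N _ _)%:R; set N2 := cover_energy _ _ (_ + _)%N _ _.
rewrite /osc [isum a (maxn i u) (minn j _)](@isum_cat a _ (u + 2 ^ k)); [|lia|lia].
set X := isum a (maxn i u) _; set Y := isum a (u + 2 ^ k) _.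
move: (normcD X Y) (normc_ge0 (X + Y)) (normc_ge0 X) (normc_ge0 Y).
set z := nrm (X + Y); set x := nrm X; set y := nrm Y => zxy z0 x0 y0 xc yc.
have c10 : 0 <= c1 by exact: ler0n.
have c20 : 0 <= c2 by exact: ler0n.
have N10 : 0 <= N1 by exact: cover_energy_ge0.
have N20 : 0 <= N2 by exact: cover_energy_ge0.
(* From x^2 <= c1 N1 and y^2 <= c2 N2, by the arithmetic-geometric mean. *)
have xy : 2 * (x * y) <= c1 * N2 + c2 * N1.
  rewrite -(@ler_pXn2r _ 2) ?nnegrE ?addr_ge0 ?mulr_ge0//.
  have : (x ^+ 2) * (y ^+ 2) <= (c1 * N1) * (c2 * N2) by rewrite ler_pM ?sqr_ge0.
  have := sqr_ge0 (c1 * N2 - c2 * N1); nra.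
have : z ^+ 2 <= (x + y) ^+ 2 by rewrite ler_pXn2r ?nnegrE ?addr_ge0.
nra.
Qed.

Lemma cover_energy_sum a (T : finType) (P : pred T) (lo hi : T -> nat) k u :
  disjoint_family P lo hi ->
  \sum_(t | P t) cover_energy a k u (lo t) (hi t) <= dyadic_energy a k u.
Proof.
move=> dj; elim: k u => [|k IH] u /=.
  apply: le_trans (disjoint_sum u dj (osc_ge0 _ _ _)); apply: ler_sum => t _.
  rewrite expn0 addn1; case: ifP => H; last by rewrite mulr_ge0 ?osc_ge0.
  by rewrite mul1r.
have o0 := osc_ge0 a u (u + 2 ^ k.+1).
apply: le_trans (lerD (disjoint_sum u dj o0) (lerD (IH u) (IH (u + 2 ^ k)%N))).
rewrite -!big_split/=; apply: ler_sum => t _.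
have e0 := expn_gt0 2 k.+1.
case: ifP => H; last by rewrite lerDr mulr_ge0 ?osc_ge0.
rewrite (_ : (_ <= _ < _)%N = true) ?mul1r; last by lia.
by rewrite lerDl addr_ge0 ?cover_energy_ge0.
Qed.

Lemma isum_supp a K i j : (forall n, (K <= n)%N -> a n = 0) ->
  isum a i j = isum a (minn i K) (minn j K).
Proof.
move=> aK; case: (leqP j i) => ij; first by rewrite /isum !big_geq//; lia.
case: (leqP K i) => iK.
  rewrite /isum [RHS]big_geq; last by lia.
  by rewrite big_nat big1// => n /andP[? ?]; apply: aK; lia.
case: (leqP j K) => jK; first by congr isum; lia.
rewrite (@isum_cat a i K j) ?(ltnW iK) ?(ltnW jK)//.
have -> : isum a K j = 0.
  by rewrite /isum big_nat big1// => n /andP[? ?]; apply: aK; lia.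
by rewrite addr0; congr isum; lia.
Qed.

Lemma var2_le_dyadic a k : (forall n, (2 ^ k <= n)%N -> a n = 0) ->
  var2_le a ((2 * k + 1)%:R * dyadic_energy a k 0).
Proof.
move=> supp T P lo hi dj.
apply: (@le_trans _ _ (\sum_(t | P t)
    (2 * k + 1)%:R * cover_energy a k 0 (lo t) (hi t))).
  apply: ler_sum => t _.
  case: (leqP (lo t) (hi t)) => lh; last first.
    by rewrite osc_geq ?(ltnW lh)// mulr_ge0 ?cover_energy_ge0.
  rewrite /osc (isum_supp _ _ supp).
  have [h|h] := leqP (2 ^ k) (lo t).
    by rewrite -/(osc _ _ _) osc_geq ?mulr_ge0 ?cover_energy_ge0//; lia.
  have := osc_cover a k 0 lh; rewrite add0n maxn0 => /le_trans; apply.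
  by rewrite ler_wpM2r ?cover_energy_ge0// ler_nat cover_card_le.
by rewrite -mulr_sumr ler_wpM2l// cover_energy_sum.
Qed.

(** ** Maximal prefix sums over dyadic intervals *)

(** Largest modulus of a prefix sum of [a] over [[u, u + 2^k)]. *)
Definition prefix_max a k u : R :=
  \big[Num.max/0]_(v < (2 ^ k).+1) nrm (isum a u (u + v)).

(** Sum of [4 * prefix_max a ^+ 2] over all dyadic subintervals of
[[u, u + 2^k)]. *)
Fixpoint max_energy a k u : R :=
  4 * prefix_max a k u ^+ 2 +
  (if k is k'.+1 then max_energy a k' u + max_energy a k' (u + 2 ^ k')%N else 0).

Lemma prefix_max_ge0 a k u : 0 <= prefix_max a k u.
Proof.
rewrite /prefix_max; elim/big_ind: _ => [//|x y x0 y0|v _].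
  by rewrite le_max x0.
exact: normc_ge0.
Qed.

Lemma prefix_max2_ge0 a k u : 0 <= 4 * prefix_max a k u ^+ 2.
Proof. by rewrite mulr_ge0 ?sqr_ge0. Qed.

Lemma prefix_max_ge a k u v : (u <= v <= u + 2 ^ k)%N ->
  nrm (isum a u v) <= prefix_max a k u.
Proof.
move=> /andP[uv vk]; have lt : (v - u < (2 ^ k).+1)%N by lia.
have := le_bigmax_cond 0 (fun v : 'I_(2 ^ k).+1 => nrm (isum a u (u + v)))
  (erefl : xpredT (Ordinal lt)).
by rewrite /= subnKC.
Qed.

Lemma osc_prefix_max a k u i j : (u <= i)%N -> (i <= j)%N -> (j <= u + 2 ^ k)%N ->
  osc a i j <= 4 * prefix_max a k u ^+ 2.
Proof.
move=> ui ij jk.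
have h1 : nrm (isum a u i) <= prefix_max a k u by apply: prefix_max_ge; lia.
have h2 : nrm (isum a u j) <= prefix_max a k u by apply: prefix_max_ge; lia.
have -> : osc a i j = nrm (isum a u j + - isum a u i) ^+ 2.
  by rewrite (@isum_cat a u i j)// addrAC subrr add0r.
have := normcD (isum a u j) (- isum a u i); rewrite (@normcN R (isum a u i)) => h3.
have := normc_ge0 (isum a u j + - isum a u i); have := prefix_max_ge0 a k u; nra.
Qed.

(** The restriction to intervals inside [[u, u + 2^k)] is part of the summand, so
that in the induction on [k] the intervals not contained in a half contribute
nothing to that half. *)
Lemma max_energy_sum a (T : finType) (P : pred T) (lo hi : T -> nat) k u :
  disjoint_family P lo hi ->
  \sum_(t | P t)
    ((u <= lo t)%N && (lo t <= hi t)%N && (hi t <= u + 2 ^ k)%N)%:R *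
    osc a (lo t) (hi t) <= max_energy a k u.
Proof.
move=> dj; elim: k u => [|k IH] u /=.
  have p0 := prefix_max2_ge0 a 0 u.
  rewrite addr0; apply: le_trans (disjoint_sum u dj p0); apply: ler_sum => t _.
  case: (boolP (_ && (hi t <= _)%N)) => [/andP[/andP[h1 h2] h3]|H].
    2: by rewrite mul0r mulr_ge0.
  rewrite mul1r; move: (h3); rewrite expn0 addn1 => h3'.
  have [e|ne] := eqVneq (lo t) (hi t); first by rewrite osc_geq ?e// mulr_ge0.
  rewrite (_ : (_ <= _ < _)%N = true) ?mul1r; last by lia.
  exact: osc_prefix_max.
have p0 := prefix_max2_ge0 a k.+1 u.
apply: le_trans (lerD (disjoint_sum (u + 2 ^ k) dj p0) (lerD (IH u) (IH (u + 2 ^ k)%N))).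
rewrite -!big_split/=; apply: ler_sum => t _.
have pc (b : bool) x : 0 <= x -> 0 <= b%:R * x :> R by move=> ?; rewrite mulr_ge0.
case: (boolP (_ && (hi t <= _)%N)) => [/andP[/andP[h1 h2] h3]|H].
  2: by rewrite mul0r addr_ge0 ?addr_ge0 ?pc ?osc_ge0.
have o0 := osc_ge0 a (lo t) (hi t).
rewrite mul1r; have [h|h] := leqP (hi t) (u + 2 ^ k).
  rewrite h1 h2 /= mul1r addrCA lerDl addr_ge0// ?pc//.
have [h'|h'] := leqP (u + 2 ^ k) (lo t).
  have -> : (hi t <= u + 2 ^ k + 2 ^ k)%N by move: h3; rewrite expnS; lia.
  by rewrite h2 /= andbF mul0r add0r mul1r lerDr pc.
rewrite (ltnW h') h2 /= !andbF !mul0r !addr0 mul1r.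
exact: osc_prefix_max.
Qed.

Lemma var2_le_max a k : (forall n, (2 ^ k <= n)%N -> a n = 0) ->
  var2_le a (max_energy a k 0).
Proof.
move=> supp T P lo hi dj.
have dj' : disjoint_family P (fun t => minn (lo t) (2 ^ k)) (fun t => minn (hi t) (2 ^ k)).
  move=> x; apply: leq_trans (dj x); apply: leq_sum => t _.
  by case: (boolP (minn _ _ <= _ < _)%N) => // H; rewrite (_ : (_ <= _ < _)%N = true)//; lia.
apply: le_trans (max_energy_sum a k 0 dj'); apply: ler_sum => t _.
rewrite /osc (isum_supp _ _ supp) -/(osc _ _ _).
have [h|h] := leqP (minn (hi t) (2 ^ k)) (minn (lo t) (2 ^ k)).
  by rewrite osc_geq// mulr_ge0 ?osc_ge0.
by rewrite (ltnW h) add0n geq_minr /= mul1r.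
Qed.

End Pointwise.

(** * Gluing consecutive blocks *)

Section Gluing.
Context {R : realType}.
Implicit Types (a : nat -> R[i]) (q : R).
Local Notation nrm := (@Normc.normc R).

(** Cauchy-Schwarz against the weights [2^-m], whose sum is at most 2. *)
Lemma sqr_sum_geometric (x : nat -> R) n :
  (\sum_(m < n) x m) ^+ 2 <= 2 * \sum_(m < n) 2 ^+ m * x m ^+ 2.
Proof.
elim: n x => [|n IH] x; first by rewrite !big_ord0 expr0n mulr0.
rewrite !big_ord_recl; move: (IH (fun m => x m.+1)).
have -> : \sum_(m < n) 2 ^+ m * x m.+1 ^+ 2 =
    2^-1 * \sum_(i < n) 2 ^+ bump 0 i * x (bump 0 i) ^+ 2.
  rewrite mulr_sumr; apply: eq_bigr => m _.
  by rewrite /bump leq0n add1n [2 ^+ m.+1]exprS; field.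
rewrite expr0 mul1r.
set S1 := \sum_(i < n) x i.+1; set S2 := \sum_(i < n) _.
set y := x ord0; move: S1 S2 y => S1 S2 y; rewrite mulrA divff ?mul1r ?pnatr_eq0// => h.
have := sqr_ge0 (y - S1); nra.
Qed.

Lemma sum_sqr_le (I : Type) (r : seq I) (P : pred I) (x : I -> R) :
  (forall i, 0 <= x i) ->
  \sum_(i <- r | P i) x i ^+ 2 <= (\sum_(i <- r | P i) x i) ^+ 2.
Proof.
move=> x0; suff: 0 <= \sum_(i <- r | P i) x i /\
  \sum_(i <- r | P i) x i ^+ 2 <= (\sum_(i <- r | P i) x i) ^+ 2 by case.
elim/big_rec2: _ => [|i y z _ [y0 h]]; first by rewrite expr0n.
by have := x0 i; split; nra.
Qed.

Lemma sqr_sum_pick n (x : nat -> R) k :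
  (\sum_(m < n) (val m == k)%:R * x m) ^+ 2 <= \sum_(m < n) x m ^+ 2.
Proof.
have [kn|kn] := ltnP k n; last first.
  rewrite big1 ?expr0n ?sumr_ge0// => [m _|m _]; first exact: sqr_ge0.
  rewrite (_ : (val m == k) = false) ?mul0r//; apply/negbTE.
  by rewrite neq_ltn (leq_trans (ltn_ord m) kn).
rewrite (bigD1 (Ordinal kn))//= eqxx mul1r big1 ?addr0.
  by rewrite (bigD1 (Ordinal kn))//= lerDl sumr_ge0// => m _; exact: sqr_ge0.
by move=> m; rewrite -val_eqE/= => /negbTE ->; rewrite mul0r.
Qed.

(** The part of [a] carried by the indices [n] with [b n = m]. *)
Definition block (b : nat -> nat) a m n : R[i] := if b n == m then a n else 0.

Lemma isum_block b a B i j : (forall n, a n != 0 -> (b n < B)%N) ->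
  isum a i j = \sum_(m < B) isum (block b a m) i j.
Proof.
move=> bB; rewrite /isum exchange_big/=; apply: eq_bigr => n _.
have [an|an] := eqVneq (a n) 0.
  by rewrite an big1// => m _; rewrite /block an; case: ifP.
rewrite (bigD1 (Ordinal (bB _ an)))//= /block eqxx big1 ?addr0// => m.
by rewrite -val_eqE/= eq_sym => /negbTE ->.
Qed.

Lemma isum0 a i j : (forall n, (i <= n < j)%N -> a n = 0) -> isum a i j = 0.
Proof. by move=> h; rewrite /isum big_nat big1. Qed.

(** The blocks [{n | b n = m}] are consecutive intervals as [b] is nondecreasing.
An interval is controlled by the variations of [a] inside the two blocks of its
endpoints and by the full sums of the blocks strictly between. *)
Lemma var2_le_glue a (b : nat -> nat) (B K : nat) (q : nat -> R) :
  (forall n, (K <= n)%N -> a n = 0) ->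
  {homo b : i j / (i <= j)%N} ->
  (forall n, (n < K)%N -> (b n < B)%N) ->
  (forall m, var2_le (block b a m) (q m)) ->
  var2_le a (6 * \sum_(m < B) q m + 6 * \sum_(m < B) 2 ^+ m * osc (block b a m) 0 K).
Proof.
move=> supp bmono bB hq T P lo hi dj.
pose c m := nrm (isum (block b a m) 0 K).
(* Block [m] lies strictly between those of the endpoints of interval [t]. *)
pose mid t m := [&& (lo t < hi t), (b (lo t) < m) & (m < b (hi t).-1)]%N.
pose Y t := \sum_(m < B) (mid t m)%:R * c m.
have c0 m : 0 <= c m by exact: normc_ge0.
have Y0 t : 0 <= Y t by apply: sumr_ge0 => m _; rewrite mulr_ge0.
have aB n : a n != 0 -> (b n < B)%N.
  by move=> an; apply: bB; rewrite ltnNge; apply: contra an => /supp ->.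
have osc_le t : osc a (lo t) (hi t) <=
    6 * (\sum_(m < B) osc (block b a m) (lo t) (hi t)) + 3 * Y t ^+ 2.
  have o0 : 0 <= \sum_(m < B) osc (block b a m) (lo t) (hi t).
    by apply: sumr_ge0 => m _; exact: osc_ge0.
  case: (leqP (hi t) (lo t)) => lh.
    by rewrite osc_geq// addr_ge0 ?mulr_ge0 ?sqr_ge0.
  pose x m := nrm (isum (block b a m) (lo t) (hi t)).
  have x0 m : 0 <= x m by exact: normc_ge0.
  have xle m : x m <= (m == b (lo t))%:R * x m +
      (m == b (hi t).-1)%:R * x m + (mid t m)%:R * c m.
    case: eqP => [_|/eqP n1]; first by rewrite mul1r -addrA lerDl addr_ge0 ?mulr_ge0.
    case: eqP => [_|/eqP n2]; first by rewrite mul0r mul1r add0r lerDl mulr_ge0.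
    rewrite !mul0r !add0r /mid lh /=.
    case: (leqP m (b (lo t))) => h1 /=.
      rewrite mul0r /x isum0 ?normc_zero// => n /andP[ln nh].
      by rewrite /block; case: eqP => // bn; have := bmono _ _ ln; lia.
    case: (leqP (b (hi t).-1) m) => h2 /=.
      rewrite mul0r /x isum0 ?normc_zero// => n /andP[ln nh].
      rewrite /block; case: eqP => // bn.
      have /bmono : (n <= (hi t).-1)%N by lia.
      by lia.
    rewrite mul1r /x /c.
    suff -> : isum (block b a m) (lo t) (hi t) = isum (block b a m) 0 K by [].
    have hK n : (K <= n)%N -> block b a m n = 0.
      by move=> Kn; rewrite /block supp//; case: ifP.
    have e n : (n < lo t)%N || (hi t <= n)%N -> block b a m n = 0.
      rewrite /block; case: eqP => // bn /orP[h|h].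
        by have := bmono n (lo t) (ltnW h); lia.
      have /bmono : ((hi t).-1 <= n)%N by lia.
      by lia.
    pose L := maxn K (hi t).
    have -> : isum (block b a m) 0 K = isum (block b a m) 0 L.
      rewrite [RHS](@isum_cat _ _ 0 K); [|lia|lia].
      by rewrite [X in _ + X]isum0 ?addr0// => n /andP[? _]; exact: hK.
    rewrite [RHS](@isum_cat _ _ 0 (lo t)); [|lia|lia].
    rewrite [X in X + _]isum0 ?add0r => [|n h]; last by apply: e; lia.
    rewrite [RHS](@isum_cat _ _ (lo t) (hi t)); [|lia|lia].
    by rewrite [X in _ + X]isum0 ?addr0// => n h; apply: e; lia.
  have nle : nrm (isum a (lo t) (hi t)) <=
     \sum_(m < B) (val m == b (lo t))%:R * x m +
     \sum_(m < B) (val m == b (hi t).-1)%:R * x m + Y t.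
    rewrite (isum_block _ _ aB) -!big_split/=.
    by apply: le_trans (normc_sum _ _ _) _; apply: ler_sum => m _; exact: xle.
  have := sqr_sum_pick B x (b (lo t)); have := sqr_sum_pick B x (b (hi t).-1).
  have -> : \sum_(m < B) x m ^+ 2 = \sum_(m < B) osc (block b a m) (lo t) (hi t) by [].
  move: nle; rewrite /osc.
  set X1 := \sum_(m < B) _; set X2 := \sum_(m < B) _; set E := \sum_(m < B) _.
  have := normc_ge0 (isum a (lo t) (hi t)); set z := nrm _ => z0 zle h2 h1.
  have z2 : z ^+ 2 <= (X1 + X2 + Y t) ^+ 2.
    by rewrite ler_pXn2r ?nnegrE ?(le_trans z0).
  have := sqr_ge0 (X1 - X2); have := sqr_ge0 (X1 - Y t); have := sqr_ge0 (X2 - Y t); nra.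
apply: le_trans (ler_sum _ (fun t _ => osc_le t)) _.
rewrite big_split/= -!mulr_sumr; apply: lerD.
  rewrite ler_wpM2l// exchange_big/=; apply: ler_sum => m _; exact: hq.
(* A nonempty block lies strictly inside at most one interval of the family. *)
have YY : \sum_(t | P t) Y t <= \sum_(m < B) c m.
  rewrite exchange_big/=; apply: ler_sum => m _.
  have [cm0|cm] := eqVneq (c m) 0.
    by rewrite big1 ?cm0// => t _; rewrite mulr0.
  have [n bn] : exists n, b n = m.
    apply: contra_neqP cm => nb; rewrite /c isum0 ?normc_zero// => n _.
    by rewrite /block; case: eqP => // bn; case: nb; exists n.
  apply: le_trans (disjoint_sum n dj (c0 m)); apply: ler_sum => t _.
  rewrite ler_wpM2r// ler_nat /mid.
  case: (boolP [&& _, _ & _])%N => // /and3P[h1 h2 h3].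
  rewrite (_ : (_ <= _ < _)%N = true)//; apply/andP; split.
    by rewrite leqNgt; apply/negP => h; have := bmono n (lo t) (ltnW h); lia.
  rewrite ltnNge; apply/negP => h.
  have /bmono : ((hi t).-1 <= n)%N by lia.
  by lia.
have := sqr_sum_geometric c B.
have -> : \sum_(m < B) 2 ^+ m * c m ^+ 2 = \sum_(m < B) 2 ^+ m * osc (block b a m) 0 K by [].
have := sum_sqr_le (index_enum T) P Y0.
have Ys0 : 0 <= \sum_(t | P t) Y t by exact: sumr_ge0.
nra.
Qed.

End Gluing.

(** * The inner product on the unit interval *)

Section L2.
Context {R : realType}.
Local Notation mu := (@lebesgue_measure R).
Local Notation T01 := (`[0%R, 1%R]%classic : set R).
Local Notation nrm := (@Normc.normc R).
Implicit Types f g h : R -> R[i].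

(** Stated for the measurable structure on which the Lebesgue measure is defined. *)
Lemma measurable_T01 : measurable (T01 : set (measurableTypeR R)).
Proof. exact: measurable_itv. Qed.
Local Hint Resolve measurable_T01 : core.

Lemma L2normE (g : R -> \bar R) :
  L2norm g = ((\int[mu]_(x in T01) (`|g x| `^ 2)) `^ 2^-1)%E.
Proof.
rewrite /L2norm unlock /= [in RHS]integral_mkcond; congr (_ `^ _)%E.
apply: eq_integral => x _; rewrite !patchE; case: ifP => // _.
by rewrite abse0 poweR0r// pnatr_eq0.
Qed.

Lemma sqr_poweR (r : R) : (`|r%:E| `^ 2 = (r ^+ 2)%:E)%E.
Proof. by rewrite abse_EFin poweR_EFin powR_mulrn// real_normK ?num_real. Qed.

Lemma L2normCE f :
  L2normC f = ((\int[mu]_(x in T01) (nrm (f x) ^+ 2)%:E) `^ 2^-1)%E.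
Proof.
by rewrite /L2normC L2normE; congr (_ `^ _)%E; apply: eq_integral => x _; exact: sqr_poweR.
Qed.

Lemma Re_mulJ (w z : R[i]) :
  complex.Re (w * conjc z) = complex.Re w * complex.Re z + complex.Im w * complex.Im z.
Proof. by case: w => a b; case: z => c d /=; rewrite mulrN opprK. Qed.

Lemma Im_mulJ (w z : R[i]) :
  complex.Im (w * conjc z) = complex.Im w * complex.Re z - complex.Re w * complex.Im z.
Proof. by case: w => a b; case: z => c d /=; rewrite mulrN addrC. Qed.

Lemma Re_mul (w z : R[i]) :
  complex.Re (w * z) = complex.Re w * complex.Re z - complex.Im w * complex.Im z.
Proof. by case: w => a b; case: z. Qed.

Lemma Im_mul (w z : R[i]) :
  complex.Im (w * z) = complex.Re w * complex.Im z + complex.Im w * complex.Re z.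
Proof. by case: w => a b; case: z. Qed.

Lemma ReD (w z : R[i]) : complex.Re (w + z) = complex.Re w + complex.Re z.
Proof. by case: w => a b; case: z. Qed.

Lemma ImD (w z : R[i]) : complex.Im (w + z) = complex.Im w + complex.Im z.
Proof. by case: w => a b; case: z. Qed.

Lemma measurable_nrm f : measurable_fun T01 (fun x => complex.Re (f x)) ->
  measurable_fun T01 (fun x => complex.Im (f x)) ->
  measurable_fun T01 (fun x => nrm (f x)).
Proof.
move=> mr mi; rewrite (_ : (fun x => _) =
    (fun x => (complex.Re (f x) ^+ 2 + complex.Im (f x) ^+ 2) `^ 2^-1)).
  apply: (measurableT_comp (measurable_powR _)).
  by apply: measurable_funD; apply: measurable_funX.
by apply/funext => x; rewrite powR12_sqrt ?addr_ge0 ?sqr_ge0//; case: (f x).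
Qed.

Lemma in_L2P f : in_L2 f <->
  [/\ measurable_fun T01 (fun x => complex.Re (f x)),
      measurable_fun T01 (fun x => complex.Im (f x))
    & mu.-integrable T01 (fun x => (nrm (f x) ^+ 2)%:E)].
Proof.
have eqI : (\int[mu]_(x in T01) `|(nrm (f x) ^+ 2)%:E| =
            \int[mu]_(x in T01) (nrm (f x) ^+ 2)%:E)%E.
  by apply: eq_integral => x _; rewrite abse_EFin ger0_norm ?sqr_ge0.
rewrite /in_L2 L2normCE; split => [[mr mi fi]|[mr mi /integrableP[_ fi]]]; split => //.
  apply/integrableP; split.
    apply/measurable_EFinP; apply: measurable_funX; exact: measurable_nrm.
  by rewrite eqI; apply: lty_poweRy fi; rewrite invr_eq0 pnatr_eq0.
by rewrite poweR_lty// -eqI.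
Qed.

Lemma in_L2_mulJ f g : in_L2 f -> in_L2 g ->
  mu.-integrable T01 (fun x => (complex.Re (f x * conjc (g x)))%:E) /\
  mu.-integrable T01 (fun x => (complex.Im (f x * conjc (g x)))%:E).
Proof.
move=> /in_L2P[rf mf fi] /in_L2P[rg mg gi].
have si := integrableD measurable_T01 fi gi.
split.
  apply: (le_integrable measurable_T01 _ _ si).
    apply/measurable_EFinP; rewrite (funext (fun x => Re_mulJ (f x) (g x))).
    by apply: measurable_funD; apply: measurable_funM.
  move=> x _; rewrite -EFinD !abse_EFin lee_fin Re_mulJ !sqr_normcE.
  set a := complex.Re _; set b := complex.Re _; set c := complex.Im _; set d := complex.Im _.
  rewrite [leRHS]ger0_norm ?addr_ge0 ?sqr_ge0// ler_norml.
  have := sqr_ge0 (a + b); have := sqr_ge0 (a - b).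
  have := sqr_ge0 (c + d); have := sqr_ge0 (c - d).
  have := sqr_ge0 a; have := sqr_ge0 b; have := sqr_ge0 c; have := sqr_ge0 d.
  by move=> *; apply/andP; split; nra.
apply: (le_integrable measurable_T01 _ _ si).
  apply/measurable_EFinP; rewrite (funext (fun x => Im_mulJ (f x) (g x))).
  by apply: measurable_funB; apply: measurable_funM.
move=> x _; rewrite -EFinD !abse_EFin lee_fin Im_mulJ !sqr_normcE.
set a := complex.Im _; set b := complex.Re _; set c := complex.Re _; set d := complex.Im _.
rewrite [leRHS]ger0_norm ?addr_ge0 ?sqr_ge0// ler_norml.
have := sqr_ge0 (a + b); have := sqr_ge0 (a - b).
have := sqr_ge0 (c + d); have := sqr_ge0 (c - d).
have := sqr_ge0 a; have := sqr_ge0 b; have := sqr_ge0 c; have := sqr_ge0 d.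
by move=> *; apply/andP; split; nra.
Qed.

Lemma in_L2_0 : in_L2 (fun=> 0 : R[i]).
Proof.
apply/in_L2P; split; try exact: measurable_cst.
rewrite [X in integrable _ _ X](_ : _ = cst 0%E); first exact: integrable0.
by apply/funext => x; rewrite normc_zero expr0n.
Qed.

Lemma in_L2D f g : in_L2 f -> in_L2 g -> in_L2 (fun x => f x + g x).
Proof.
move=> /in_L2P[rf mf fi] /in_L2P[rg mg gi].
have mr : measurable_fun T01 (fun x => complex.Re (f x + g x)).
  by rewrite (funext (fun x => ReD (f x) (g x))); exact: measurable_funD.
have mi : measurable_fun T01 (fun x => complex.Im (f x + g x)).
  by rewrite (funext (fun x => ImD (f x) (g x))); exact: measurable_funD.
apply/in_L2P; split => //.
have si := integrableZl measurable_T01 2 (integrableD measurable_T01 fi gi).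
apply: (le_integrable measurable_T01 _ _ si).
  by apply/measurable_EFinP; apply: measurable_funX; exact: measurable_nrm.
move=> x _; rewrite -EFinD -EFinM !abse_EFin lee_fin.
rewrite !ger0_norm ?mulr_ge0 ?addr_ge0 ?sqr_ge0 ?normc_ge0//.
rewrite !sqr_normcE ReD ImD.
set a := complex.Re _; set b := complex.Re _; set c := complex.Im _; set d := complex.Im _.
have := sqr_ge0 (a - b); have := sqr_ge0 (c - d); nra.
Qed.

Lemma in_L2Z (c : R[i]) f : in_L2 f -> in_L2 (fun x => c * f x).
Proof.
move=> /in_L2P[rf mf fi]; apply/in_L2P; split.
- rewrite (funext (fun x => Re_mul c (f x))).
  by apply: measurable_funB; apply: measurable_funM => //; exact: measurable_cst.
- rewrite (funext (fun x => Im_mul c (f x))).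
  by apply: measurable_funD; apply: measurable_funM => //; exact: measurable_cst.
- rewrite [X in integrable _ _ X](_ : _ =
      fun x => ((nrm c ^+ 2)%:E * (nrm (f x) ^+ 2)%:E)%E).
    exact: integrableZl.
  by apply/funext => x; rewrite Normc.normcM exprMn EFinM.
Qed.

Lemma in_L2_sum (I : Type) (r : seq I) (P : pred I) (F : I -> R -> R[i]) :
  (forall i, P i -> in_L2 (F i)) -> in_L2 (fun x => \sum_(i <- r | P i) F i x).
Proof.
move=> FL; elim: r => [|i r IH].
  rewrite [X in in_L2 X](_ : _ = fun=> 0); first exact: in_L2_0.
  by apply/funext => x; rewrite big_nil.
rewrite [X in in_L2 X](_ : _ = fun x =>
    if P i then F i x + \sum_(j <- r | P j) F j x
    else \sum_(j <- r | P j) F j x); last first.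
  by apply/funext => x; rewrite big_cons.
by case: (boolP (P i)) => [Pi|_]//; apply: in_L2D => //; exact: FL.
Qed.

Lemma inner0 g : inner (fun=> 0) g = 0.
Proof.
rewrite /inner; congr Complex; rewrite /Rintegral integral0_eq// => x _;
  by rewrite mul0r.
Qed.

Lemma innerD f g h : in_L2 f -> in_L2 g -> in_L2 h ->
  inner (fun x => f x + g x) h = inner f h + inner g h.
Proof.
move=> Lf Lg Lh.
have [rf mf] := in_L2_mulJ Lf Lh; have [rg mg] := in_L2_mulJ Lg Lh.
rewrite /inner /=; apply/eqP; rewrite eq_complex /=; apply/andP; split; apply/eqP.
  rewrite -RintegralD//; apply: eq_Rintegral => x _; by rewrite mulrDl ReD.
by rewrite -RintegralD//; apply: eq_Rintegral => x _; rewrite mulrDl ImD.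
Qed.

Lemma innerZ c f h : in_L2 f -> in_L2 h ->
  inner (fun x => c * f x) h = c * inner f h.
Proof.
move=> Lf Lh; have [rf mf] := in_L2_mulJ Lf Lh.
have rZ k : mu.-integrable T01 (EFin \o (fun x => k * complex.Re (f x * conjc (h x)))).
  by exact: (integrableZl measurable_T01 k rf).
have mZ k : mu.-integrable T01 (EFin \o (fun x => k * complex.Im (f x * conjc (h x)))).
  by exact: (integrableZl measurable_T01 k mf).
apply/eqP; rewrite eq_complex Re_mul Im_mul; rewrite /inner /=; apply/andP; split; apply/eqP.
  rewrite -!RintegralZl// -RintegralB//.
  by apply: eq_Rintegral => x _; rewrite -mulrA Re_mul.
rewrite -!RintegralZl// -RintegralD//.
by apply: eq_Rintegral => x _; rewrite -mulrA Im_mul.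
Qed.

Lemma innerC f g : in_L2 f -> in_L2 g -> inner f g = conjc (inner g f).
Proof.
move=> Lf Lg; have [_ mg] := in_L2_mulJ Lg Lf.
rewrite /inner /=; congr Complex.
  by apply: eq_Rintegral => x _; rewrite !Re_mulJ; ring.
rewrite -mulN1r -RintegralZl//.
by apply: eq_Rintegral => x _; rewrite !Im_mulJ; ring.
Qed.

Lemma inner_sum (I : Type) (r : seq I) (P : pred I) (c : I -> R[i])
    (F : I -> R -> R[i]) h :
  (forall i, P i -> in_L2 (F i)) -> in_L2 h ->
  inner (fun x => \sum_(i <- r | P i) c i * F i x) h =
  \sum_(i <- r | P i) c i * inner (F i) h.
Proof.
move=> FL Lh; elim: r => [|i r IH].
  by rewrite big_nil -[RHS](inner0 h); congr inner; apply/funext => x; rewrite big_nil.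
rewrite big_cons -IH; case: ifP => Pi; last first.
  by congr inner; apply/funext => x; rewrite big_cons Pi.
rewrite -innerZ//; last exact: FL.
rewrite -innerD//; first last.
- by apply: in_L2_sum => k Pk; apply: in_L2Z; exact: FL.
- by apply: in_L2Z; exact: FL.
by congr inner; apply/funext => x; rewrite big_cons Pi.
Qed.

Lemma inner_self f : in_L2 f ->
  (\int[mu]_(x in T01) (nrm (f x) ^+ 2)%:E = (complex.Re (inner f f))%:E)%E.
Proof.
move=> /in_L2P[_ _ fi]; rewrite /inner /= -(@fineK _ (integral _ _ _)).
  congr EFin; rewrite /Rintegral; congr fine; apply: eq_integral => x _.
  by rewrite Re_mulJ sqr_normcE !expr2.
exact: integrable_fin_num.
Qed.

(** An orthonormal system indexed from 0. *)
Definition orthonormal_seq (psi : nat -> R -> R[i]) :=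
  (forall n, in_L2 (psi n)) /\ (forall m n, inner (psi m) (psi n) = (m == n)%:R).

Section ons.
Variables (psi : nat -> R -> R[i]).
Hypothesis ons : orthonormal_seq psi.
Implicit Types al : nat -> R[i].

(** The sequence of terms of the series with coefficients [al] at the point [x]. *)
Definition term al (x : R) n := al n * psi n x.

Lemma in_L2_isum al i j : in_L2 (fun x => isum (term al x) i j).
Proof.
by apply: in_L2_sum => n _; apply: in_L2Z; exact: ons.1.
Qed.

Lemma inner_isum al i j k :
  inner (fun x => isum (term al x) i j) (psi k) = if (i <= k < j)%N then al k else 0.
Proof.
rewrite inner_sum; [|by move=> n _; exact: ons.1|exact: ons.1].
under eq_bigr do rewrite ons.2.
case: ifP => kij.
  rewrite (bigD1_seq k) ?mem_index_iota ?iota_uniq//=.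
  rewrite eqxx mulr1 big1 ?addr0// => n /negbTE ->; by rewrite mulr0.
rewrite big_nat big1// => n nij; case: eqP => [e|_]; last by rewrite mulr0.
by rewrite -e nij in kij.
Qed.

(** Parseval's identity for a finite sum. *)
Lemma integral_osc al i j :
  (\int[mu]_(x in T01) (osc (term al x) i j)%:E =
   (\sum_(i <= n < j) nrm (al n) ^+ 2)%:E)%E.
Proof.
rewrite /osc inner_self; last exact: in_L2_isum.
congr EFin; rewrite inner_sum; [|by move=> n _; exact: ons.1|exact: in_L2_isum].
rewrite (@big_morph _ _ (@complex.Re R) 0 +%R)//; last exact: ReD.
apply: eq_big_nat => n nij.
rewrite innerC ?inner_isum ?nij; [|exact: ons.1|exact: in_L2_isum].
by rewrite Re_mulJ sqr_normcE !expr2.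
Qed.

Lemma measurable_osc al i j : measurable_fun T01 (fun x => osc (term al x) i j).
Proof.
have [mr mi _] := in_L2_isum al i j.
by apply: measurable_funX; exact: measurable_nrm.
Qed.

End ons.
End L2.

(** * Integrated variation bounds *)

Section Integrated.
Context {R : realType}.
Local Notation mu := (@lebesgue_measure R).
Local Notation T01 := (`[0%R, 1%R]%classic : set R).
Local Notation nrm := (@Normc.normc R).
Local Hint Extern 0 (measurable _) => exact: measurable_T01 : core.
Implicit Types (Q : R -> R) (c : R) (al : nat -> R[i]).

(** [Q] is nonnegative and measurable, with integral at most [c]. *)
Definition int_le Q c :=
  [/\ measurable_fun T01 Q, (forall x, 0 <= Q x) &
      (\int[mu]_(x in T01) (Q x)%:E <= c%:E)%E].

Lemma int_le_trans Q c c' : c <= c' -> int_le Q c -> int_le Q c'.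
Proof. by move=> cc' [mQ Q0 iQ]; split => //; apply: le_trans iQ _; rewrite lee_fin. Qed.

Lemma int_leD Q1 Q2 c1 c2 : int_le Q1 c1 -> int_le Q2 c2 ->
  int_le (fun x => Q1 x + Q2 x) (c1 + c2).
Proof.
move=> [m1 p1 i1] [m2 p2 i2]; split.
- exact: measurable_funD.
- by move=> x; rewrite addr_ge0.
- under eq_integral do rewrite EFinD.
  rewrite ge0_integralD//; first by rewrite EFinD leeD.
  + by move=> x _; rewrite lee_fin.
  + exact/measurable_EFinP.
  + by move=> x _; rewrite lee_fin.
  + exact/measurable_EFinP.
Qed.

Lemma int_leZ Q c k : 0 <= k -> int_le Q c -> int_le (fun x => k * Q x) (k * c).
Proof.
move=> k0 [m1 p1 i1]; split.
- by apply: measurable_funM => //; exact: measurable_cst.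
- by move=> x; rewrite mulr_ge0.
- under eq_integral do rewrite EFinM.
  rewrite ge0_integralZl_EFin//; first by rewrite EFinM; apply: lee_wpmul2l; rewrite ?lee_fin.
  + by move=> x _; rewrite lee_fin.
  + exact/measurable_EFinP.
Qed.

Lemma int_le_0 : int_le (fun=> 0) 0.
Proof. by split => //; rewrite integral0. Qed.

Lemma int_le_sum n (Q : nat -> R -> R) (c : nat -> R) :
  (forall m, int_le (Q m) (c m)) ->
  int_le (fun x => \sum_(m < n) Q m x) (\sum_(m < n) c m).
Proof.
move=> h; elim: n => [|n IH].
  rewrite big_ord0 (_ : (fun _ => _) = fun=> 0); first exact: int_le_0.
  by apply/funext => x; rewrite big_ord0.
rewrite big_ord_recr (_ : (fun _ => _) = fun x => \sum_(m < n) Q m x + Q n x).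
  exact: int_leD.
by apply/funext => x; rewrite big_ord_recr.
Qed.

Section ons.
Variable psi : nat -> R -> R[i].
Hypothesis ons : orthonormal_seq psi.

Lemma int_le_osc al i j :
  int_le (fun x => osc (term psi al x) i j) (\sum_(i <= n < j) nrm (al n) ^+ 2).
Proof.
split; [exact: measurable_osc|by move=> x; exact: osc_ge0|].
by rewrite integral_osc.
Qed.

(** The squared 2-variation of the series with coefficients [al] has a measurable
majorant with integral at most [c]. *)
Definition var2_L2_le al c := exists Q, int_le Q c /\
  forall x, T01 x -> var2_le (term psi al x) (Q x).

Lemma term_block b al m x : term psi (block b al m) x = block b (term psi al x) m.
Proof. by apply/funext => n; rewrite /term /block; case: ifP => // _; rewrite mul0r. Qed.

Section glue.
Variables (w : nat -> R) (B : R).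
Hypothesis w1 : forall n, 1 <= w n.
Hypothesis wmono : {homo w : m n / (m <= n)%N >-> m <= n}.
Hypothesis B0 : 0 <= B.
Hypothesis BB : forall N al, (forall n, (N < n)%N -> al n = 0) ->
  var2_L2_le al (B * w N * \sum_(0 <= n < N.+1) nrm (al n) ^+ 2).

(** Index of the block of [n]: the integer part of the binary logarithm of [w n]. *)
Definition level n := trunc_log 2 (Num.truncn (w n)).

Lemma level_bounds n : 2 ^+ level n <= w n < 2 ^+ (level n).+1.
Proof.
have /andP[t1 t2] : (Num.truncn (w n))%:R <= w n < (Num.truncn (w n)).+1%:R.
  by apply: truncn_itv; exact: le_trans (w1 n).
have t0 : (0 < Num.truncn (w n))%N.
  rewrite lt0n; apply/eqP => e; rewrite e in t2; have := w1 n; lra.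
have /andP[l1 l2] := trunc_log_bounds (erefl : (1 < 2)%N) t0.
rewrite -!natrX; apply/andP; split.
  by apply: le_trans t1; rewrite ler_nat.
by apply: lt_le_trans t2 _; rewrite ler_nat.
Qed.

Lemma level_mono : {homo level : m n / (m <= n)%N}.
Proof. by move=> m n mn; apply: leq_trunc_log; apply: le_truncn; exact: wmono. Qed.

Lemma var2_L2_le_block K al m : (forall n, (K <= n)%N -> al n = 0) ->
  var2_L2_le (block level al m)
    (2 * B * \sum_(0 <= n < K) w n * nrm (block level al m n) ^+ 2).
Proof.
move=> supp.
have pos n : 0 <= w n * nrm (block level al m n) ^+ 2.
  by rewrite mulr_ge0 ?sqr_ge0// (le_trans _ (w1 n)).
(* [N] is the largest index carrying the block, or 0 when the block vanishes. *)
suff [N [NK hN wN]] : exists N,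
  [/\ (N.+1 <= K)%N \/ (forall n, block level al m n = 0),
    (forall n, (N < n)%N -> block level al m n = 0) &
    (forall n, block level al m n != 0 -> w N <= 2 * w n)].
  have [Q [iQ vQ]] := BB hN; exists Q; split => //; apply: int_le_trans iQ.
  rewrite mulrAC [2 * B]mulrC -!mulrA ler_wpM2l// !mulr_sumr.
  apply: (@le_trans _ _
    (\sum_(0 <= n < N.+1) 2 * (w n * nrm (block level al m n) ^+ 2))).
    rewrite mulr_suml; apply: ler_sum => n _.
    have [->|e] := eqVneq (block level al m n) 0.
      by rewrite normc_zero expr0n/= mul0r !mulr0.
    by rewrite mulrC mulrA ler_wpM2r ?sqr_ge0// wN.
  case: NK => [NK|z].
    rewrite [leRHS](@big_cat_nat _ _ _ N.+1)//= lerDl; apply: sumr_ge0 => n _.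
    by rewrite mulr_ge0.
  rewrite big1 => [|n _]; first by apply: sumr_ge0 => n _; rewrite mulr_ge0.
  by rewrite z normc_zero expr0n/= !mulr0.
case: (pselect (exists n, block level al m n != 0)) => [ex|nex]; last first.
  have z n : block level al m n = 0.
    by apply: contrapT => /eqP ne; apply: nex; exists n.
  by exists 0%N; split; [right|move=> n _|move=> n; rewrite z eqxx].
have ub n : block level al m n != 0 -> (n <= K)%N.
  rewrite leqNgt; apply: contra => nK; rewrite /block supp ?if_same//; lia.
case: (ex_maxnP ex ub) => N bN maxN; exists N; split.
- left; rewrite ltnNge; apply: contra bN => KN.
  by rewrite /block supp ?if_same.
- move=> n Nn; apply/eqP; apply: contraTT Nn => /maxN; lia.
- move=> n bn.
  have lN : level N = m.
    by apply/eqP; move: bN; rewrite /block; case: ifP => // _; rewrite eqxx.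
  have ln : level n = m.
    by apply/eqP; move: bn; rewrite /block; case: ifP => // _; rewrite eqxx.
  have /andP[_] := level_bounds N; have /andP[+ _] := level_bounds n.
  by rewrite lN ln exprS; lra.
Qed.

(** A bound involving only the weight of the largest index of the support improves
to one where each coefficient has its own weight. *)
Lemma var2_L2_le_glue K al : (forall n, (K <= n)%N -> al n = 0) ->
  var2_L2_le al ((12 * B + 6) * \sum_(0 <= n < K) w n * nrm (al n) ^+ 2).
Proof.
move=> supp.
have [Q HQ] := choice (fun m => var2_L2_le_block m supp).
pose L := (level K).+1.
exists (fun x => 6 * \sum_(m < L) Q m x +
  6 * \sum_(m < L) 2 ^+ m * osc (term psi (block level al m) x) 0 K); split.
  have s2 m : int_le (fun x => 2 ^+ m * osc (term psi (block level al m) x) 0 K)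
     (2 ^+ m * \sum_(0 <= n < K) nrm (block level al m n) ^+ 2).
    by apply: int_leZ; [exact: exprn_ge0|exact: int_le_osc].
  have := int_leD (int_leZ (ler0n _ 6) (int_le_sum L (fun m => (HQ m).1)))
                  (int_leZ (ler0n _ 6) (int_le_sum L s2)).
  apply: int_le_trans; rewrite -mulr_sumr.
  set S1 := \sum_(m < L) _; set S2 := \sum_(m < L) _; set S := \sum_(0 <= n < K) _.
  have S1S : S1 <= S.
    rewrite /S1 exchange_big/=; apply: ler_sum_nat => n /andP[_ nK].
    rewrite -mulr_sumr ler_wpM2l ?(le_trans _ (w1 n))//.
    have lt : (level n < L)%N by rewrite ltnS level_mono// ltnW.
    rewrite (bigD1 (Ordinal lt))//= /block eqxx big1 ?addr0// => i.
    by rewrite -val_eqE/= eq_sym => /negbTE ->; rewrite normc_zero expr0n.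
  have S2S : S2 <= S1.
    apply: ler_sum => m _; rewrite mulr_sumr; apply: ler_sum => n _.
    rewrite /block; case: eqP => [<-|_]; last by rewrite normc_zero expr0n !mulr0.
    by rewrite ler_wpM2r ?sqr_ge0//; have /andP[] := level_bounds n.
  move: S1S S2S (ler_wpM2l B0 S1S); move: S1 S2 S => S1 S2 S; nra.
move=> x Tx; under [X in _ + _ * X]eq_bigr do rewrite term_block.
apply: (@var2_le_glue _ _ _ _ _ (fun m => Q m x)).
- by move=> n Kn; rewrite /term supp// mul0r.
- exact: level_mono.
- by move=> n nK; rewrite ltnS level_mono// ltnW.
- by move=> m; rewrite -term_block; exact: (HQ m).2.
Qed.
End glue.
End ons.
End Integrated.

(** * The two dyadic bounds *)

Section Blocks.
Context {R : realType}.
Local Notation mu := (@lebesgue_measure R).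
Local Notation T01 := (`[0%R, 1%R]%classic : set R).
Local Notation nrm := (@Normc.normc R).
Local Hint Extern 0 (measurable _) => exact: measurable_T01 : core.
Implicit Types (al : nat -> R[i]) (psi : nat -> R -> R[i]).

(** Positive integer comparable to [ln (n + 2)] with [n.+1 < 2 ^ dlevel n]. *)
Definition dlevel n := (trunc_log 2 n.+1).+1.

Lemma ltn_dlevel n : (n.+1 < 2 ^ dlevel n)%N.
Proof. by have /andP[] := trunc_log_bounds (erefl : (1 < 2)%N) (ltn0Sn n). Qed.

Lemma dlevel_mono : {homo dlevel : m n / (m <= n)%N}.
Proof. by move=> m n mn; rewrite /dlevel ltnS; apply: leq_trunc_log. Qed.

Lemma sum_supp al N K : (forall n, (N < n)%N -> al n = 0) -> (N < K)%N ->
  \sum_(0 <= n < K) nrm (al n) ^+ 2 = \sum_(0 <= n < N.+1) nrm (al n) ^+ 2.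
Proof.
move=> supp NK; rewrite (@big_cat_nat _ _ _ N.+1)//=.
rewrite [X in _ + X]big_nat [X in _ + X]big1 ?addr0// => n /andP[Nn _].
by rewrite supp// normc_zero expr0n.
Qed.

Lemma int_le_dyadic_energy psi al k u : orthonormal_seq psi ->
  int_le (fun x => dyadic_energy (term psi al x) k u)
    (k.+1%:R * \sum_(u <= n < u + 2 ^ k) nrm (al n) ^+ 2).
Proof.
move=> ons; elim: k u => [|k IH] u /=.
  by rewrite mul1r expn0 addn1; exact: int_le_osc.
have := int_leD (int_le_osc ons al u (u + 2 ^ k.+1)) (int_leD (IH u) (IH (u + 2 ^ k)%N)).
apply: int_le_trans; rewrite expnS mul2n -addnn addnA.
rewrite -mulrDr -(@big_cat_nat _ _ _ (u + 2 ^ k) _ (u + 2 ^ k + 2 ^ k))/= ?leq_addr//.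
by rewrite -[X in X + _]mul1r -mulrDl nat1r.
Qed.

(** The variation bound for an arbitrary orthonormal system. *)
Lemma var2_L2_le_log psi al N : orthonormal_seq psi ->
  (forall n, (N < n)%N -> al n = 0) ->
  var2_L2_le psi al (6 * ((dlevel N)%:R ^+ 2) * \sum_(0 <= n < N.+1) nrm (al n) ^+ 2).
Proof.
move=> ons supp; set k := dlevel N; have Nk := ltn_dlevel N.
exists (fun x => (2 * k + 1)%:R * dyadic_energy (term psi al x) k 0); split; last first.
  move=> x _; apply: var2_le_dyadic => n kn.
  by rewrite /term supp ?mul0r// (leq_trans _ kn)// ltnW.
have := int_leZ (ler0n _ (2 * k + 1)) (int_le_dyadic_energy al k 0 ons).
rewrite add0n (sum_supp supp (ltnW Nk)); apply: int_le_trans.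
rewrite mulrA ler_wpM2r ?sumr_ge0//; first by move=> n _; exact: sqr_ge0.
rewrite -natrM -natrX -natrM ler_nat.
have : (0 < k)%N by [].
nia.
Qed.

Lemma int_le_max_energy psi al k u (D : R) :
  (forall k u, int_le (fun x => prefix_max (term psi al x) k u ^+ 2)
    (D * \sum_(u <= n < u + 2 ^ k) nrm (al n) ^+ 2)) ->
  int_le (fun x => max_energy (term psi al x) k u)
    (k.+1%:R * (4 * D) * \sum_(u <= n < u + 2 ^ k) nrm (al n) ^+ 2).
Proof.
move=> H; elim: k u => [|k IH] u /=.
  have := int_leD (int_leZ (ler0n _ 4) (H 0%N u)) int_le_0.
  by apply: int_le_trans; rewrite addr0 mul1r mulrA.
have := int_leD (int_leZ (ler0n _ 4) (H k.+1 u)) (int_leD (IH u) (IH (u + 2 ^ k)%N)).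
apply: int_le_trans; rewrite expnS mul2n -addnn addnA.
rewrite -mulrDr -(@big_cat_nat _ _ _ (u + 2 ^ k) _ (u + 2 ^ k + 2 ^ k))/= ?leq_addr//.
by rewrite [4 * (D * _)]mulrA -mulrDl -[k.+2%:R]nat1r [(1 + _) * (4 * D)]mulrDl mul1r.
Qed.

(** The variation bound deduced from a maximal inequality with constant [D]
for the squares. *)
Lemma var2_L2_le_max psi al N (D : R) : 0 <= D ->
  (forall n, (N < n)%N -> al n = 0) ->
  (forall k u, int_le (fun x => prefix_max (term psi al x) k u ^+ 2)
    (D * \sum_(u <= n < u + 2 ^ k) nrm (al n) ^+ 2)) ->
  var2_L2_le psi al (8 * (D * (dlevel N)%:R) * \sum_(0 <= n < N.+1) nrm (al n) ^+ 2).
Proof.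
move=> D0 supp H; set k := dlevel N; have Nk := ltn_dlevel N.
exists (fun x => max_energy (term psi al x) k 0); split; last first.
  move=> x _; apply: var2_le_max => n kn.
  by rewrite /term supp ?mul0r// (leq_trans _ kn)// ltnW.
have := int_le_max_energy k 0 H.
rewrite add0n (sum_supp supp (ltnW Nk)); apply: int_le_trans.
rewrite ler_wpM2r ?sumr_ge0//; first by move=> n _; exact: sqr_ge0.
have k1 : k.+1%:R <= 2 * k%:R :> R by rewrite -natrM ler_nat /k /dlevel; lia.
by have := ler_wpM2r D0 k1; nra.
Qed.

Lemma dlevel_ln n : (dlevel n)%:R <= 2 / ln 2 * ln n.+2%:R :> R.
Proof.
have l2 : 0 < ln 2 :> R by rewrite ln_gt0// ltr1n.
have h : ln 2 <= ln n.+2%:R :> R by rewrite ler_ln ?posrE// ler_nat.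
have /andP[t _] := trunc_log_bounds (erefl : (1 < 2)%N) (ltn0Sn n).
have : ln 2 *+ trunc_log 2 n.+1 <= ln n.+2%:R :> R.
  rewrite -lnXn// ler_ln ?posrE ?exprn_gt0//.
  by rewrite -natrX ler_nat (leq_trans t).
rewrite /dlevel; set m := trunc_log _ _ => hm.
rewrite mulrAC ler_pdivlMr// -natr1 mulrDl mul1r mulr_natl; lra.
Qed.

End Blocks.

(** * The variation norm *)

Section Variation.
Context {R : realType}.
Local Notation mu := (@lebesgue_measure R).
Local Notation T01 := (`[0%R, 1%R]%classic : set R).
Local Notation nrm := (@Normc.normc R).
Local Hint Extern 0 (measurable _) => exact: measurable_T01 : core.
Implicit Types (a b : nat -> R[i]) (K : nat).

Lemma interval_partition_bounds K (P : {set {set 'I_K}}) : interval_partition P ->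
  exists p : {set 'I_K} -> nat * nat, forall I, I \in P ->
    ((p I).2 <= K)%N /\ forall k : 'I_K, (k \in I) = ((p I).1 <= k < (p I).2)%N.
Proof.
move=> /andP[_ /forall_inP sub].
suff /choice[p pP] : forall I, exists p : nat * nat, I \in P ->
    (p.2 <= K)%N /\ forall k : 'I_K, (k \in I) = (p.1 <= k < p.2)%N.
  by exists p.
move=> I.
have [IP|IP] := boolP (I \in P); last by exists (0, 0)%N.
have /existsP[i /existsP[j /eqP ->]] := sub I IP.
by exists (val i, (val j).+1); split=> [|k]; [exact: ltn_ord|rewrite inE ltnS].
Qed.

Lemma Vnorm_fin_ge0 K b : 0 <= Vnorm_fin 2 K b.
Proof.
rewrite /Vnorm_fin; elim/big_ind: _ => [//|x y x0 y0|P _]; last exact: powR_ge0.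
by rewrite le_max x0.
Qed.

Lemma Vnorm_fin_sqr_le K a b q : (forall n, (n < K)%N -> a n = b n.+1) -> 0 <= q ->
  var2_le a q -> Vnorm_fin 2 K b ^+ 2 <= q.
Proof.
move=> ab q0 aq; rewrite -(sqr_sqrtr q0) ler_pXn2r ?nnegrE ?Vnorm_fin_ge0 ?sqrtr_ge0//.
rewrite /Vnorm_fin; apply/bigmax_leP; split => [|P ivP]; first exact: sqrtr_ge0.
rewrite powR12_sqrt ?sumr_ge0//; last by move=> I _; exact: powR_ge0.
apply: ler_wsqrtr; have [p pP] := interval_partition_bounds ivP.
apply: le_trans (aq _ (mem P) (fun I => (p I).1) (fun I => (p I).2) _).
  apply: ler_sum => I IP; have [pK pI] := pP I IP.
  rewrite powR_mulrn ?normc_ge0// /osc /isum.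
  suff -> : \sum_(k in I) b k.+1 = \sum_((p I).1 <= k < (p I).2) a k by [].
  rewrite (big_nat_widen _ _ K)// (big_nat_widenl _ 0)// big_mkord.
  by apply: eq_big => [k|k _]; [rewrite pI /= andbC|rewrite ab].
move=> x; have [xK|Kx] := ltnP x K; last first.
  rewrite big1// => I IP; have [pK _] := pP I IP.
  by rewrite [(x < _)%N]ltnNge (leq_trans pK Kx) andbF.
have /andP[/and3P[_ tP _] _] := ivP.
pose c := finset.pblock P (Ordinal xK).
apply: (@leq_trans (\sum_(I : {set 'I_K}) (I == c))); last first.
  by rewrite (bigD1 c)//= eqxx big1// => I /negbTE ->.
rewrite [leqLHS]big_mkcond; apply: leq_sum => I _; case: ifP => // IP.
have [_ pI] := pP I IP; rewrite -(pI (Ordinal xK)).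
by case: (boolP (_ \in I)) => // xI; rewrite /c (finset.def_pblock tP IP xI) eqxx.
Qed.

(** A partition of the first [K] indices becomes one of the first [K.+1] after
adding the singleton of the last index. *)
Lemma Vnorm_finS K b : Vnorm_fin 2 K b <= Vnorm_fin 2 K.+1 b.
Proof.
apply/bigmax_leP; split => [|P ivP]; first exact: Vnorm_fin_ge0.
pose w := widen_ord (leqnSn K).
have w_inj : injective w by move=> x y /(congr1 val) /= /val_inj.
have w_max y : w y != ord_max by rewrite -val_eqE /= ltn_eqF.
have wP (x : 'I_K.+1) : x = ord_max \/ exists y, x = w y.
  have [->|xm] := eqVneq x ord_max; [by left|right].
  have xK : (x < K)%N.
    by move: xm (ltn_ord x); rewrite -val_eqE/= ltnS leq_eqVlt => /negbTE ->.
  by exists (Ordinal xK); apply: val_inj.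
pose P' := ([set ord_max] |: [set w @: (I : {set 'I_K}) | I in P])%SET.
have nin : [set ord_max]%SET \notin [set w @: (I : {set 'I_K}) | I in P]%SET.
  apply/imsetP => -[I _ e].
  have : ord_max \in [set (ord_max : 'I_K.+1)]%SET by rewrite inE.
  by rewrite e => /imsetP[y _ /eqP]; rewrite eq_sym (negbTE (w_max y)).
have /andP[/and3P[/eqP cP tP nP] /forall_inP sP] := ivP.
have ivP' : interval_partition P'.
  apply/andP; split; last first.
    apply/forall_inP => A; rewrite inE => /orP[|/imsetP[I IP ->]].
      rewrite inE => /eqP ->; apply/existsP; exists ord_max; apply/existsP; exists ord_max.
      apply/eqP/setP => k; rewrite !inE -val_eqE /=.
      by apply/eqP/idP => [->|]; [rewrite leqnn|move=> h; have := ltn_ord k; lia].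
    have /existsP[i /existsP[j /eqP ->]] := sP I IP.
    apply/existsP; exists (w i); apply/existsP; exists (w j).
    apply/eqP/setP => k; rewrite inE; apply/imsetP/idP => [[y]|h].
      by rewrite inE => yij ->.
    have [e|[y ky]] := wP k; last by exists y; rewrite // inE; move: h; rewrite ky.
    by move: h; rewrite e /=; have := ltn_ord j; lia.
  apply/and3P; split.
  - apply/eqP/setP => x; rewrite inE; apply/bigcupP.
    have [->|[y ->]] := wP x; first by exists [set ord_max]%SET; rewrite !inE ?eqxx.
    have yP : y \in finset.cover P by rewrite cP inE.
    exists (w @: finset.pblock P y); last by apply: imset_f; rewrite finset.mem_pblock.
    by rewrite inE; apply/orP; right; apply: imset_f; exact: finset.pblock_mem.
  - have dmax (I : {set 'I_K}) : [disjoint [set ord_max]%SET & (w @: I)%SET]%B.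
      rewrite disjoints1; apply/imsetP => -[y _ /eqP].
      by rewrite eq_sym (negbTE (w_max y)).
    apply/finset.trivIsetP => A1 A2; rewrite !inE.
    move=> /orP[/eqP ->|/imsetP[I IP ->]] /orP[/eqP ->|/imsetP[J JP ->]] ne.
    + by rewrite eqxx in ne.
    + exact: dmax.
    + by rewrite disjoint_sym.
    + rewrite imset_disjoint//.
      by move/finset.trivIsetP: tP; apply => //; apply: contraNneq ne => ->.
  - rewrite !inE negb_or; apply/andP; split.
      by rewrite eq_sym; apply/set0Pn; exists ord_max; rewrite inE.
    apply/imsetP => -[I IP /esym/eqP]; rewrite imset_eq0 => /eqP I0.
    by rewrite I0 (negbTE nP) in IP.
apply: le_trans (le_bigmax_cond 0 (fun P : {set {set 'I_K.+1}} =>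
   (\sum_(I in P) Normc.normc (\sum_(k in I) b k.+1) `^ 2) `^ 2^-1) ivP').
apply: ge0_ler_powR; rewrite ?nnegrE ?sumr_ge0//.
1,2: by move=> I _; exact: powR_ge0.
rewrite /P' big_setU1//= big_imset/=; last by move=> I J _ _; exact: imset_inj.
rewrite -[leLHS]add0r; apply: lerD; first exact: powR_ge0.
apply: ler_sum => I _; rewrite big_imset//=; by move=> x y _ _; exact: w_inj.
Qed.

Lemma Vnorm_fin_nd b : {homo (fun K => Vnorm_fin 2 K b) : m n / (m <= n)%N >-> m <= n}.
Proof. by apply: homo_leq => // [x y z|K]; [exact: le_trans|exact: Vnorm_finS]. Qed.

Lemma Vnorm_sqr b :
  (`|Vnorm 2 b| `^ 2 = limn (fun K => (Vnorm_fin 2 K b ^+ 2)%:E))%E.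
Proof.
have nd : nondecreasing_seq (fun K => (Vnorm_fin 2 K b)%:E).
  by move=> m n mn; rewrite lee_fin Vnorm_fin_nd.
have cv := ereal_nondecreasing_is_cvgn nd.
have V0 : (0 <= Vnorm 2 b)%E.
  by apply: lime_ge => //; apply: nearW => K; rewrite lee_fin Vnorm_fin_ge0.
rewrite gee0_abs//.
have -> : (Vnorm 2 b `^ 2 = Vnorm 2 b * Vnorm 2 b)%E.
  case: (Vnorm 2 b) V0 => [r||]//; last by rewrite poweRyr ?pnatr_eq0// mulyy.
  by rewrite lee_fin => r0; rewrite poweR_EFin powR_mulrn// expr2 EFinM.
have VV : mule_def (Vnorm 2 b) (Vnorm 2 b).
  by case: (Vnorm 2 b).
apply: esym; apply: cvg_lim => //.
under eq_fun do rewrite expr2 EFinM.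
exact: (cvgeM VV cv cv).
Qed.

Lemma measurable_bigmax (I : Type) (r : seq I) (P : pred I) (F : I -> R -> R) :
  (forall i, P i -> measurable_fun T01 (F i)) ->
  measurable_fun T01 (fun x => \big[Num.max/0]_(i <- r | P i) F i x).
Proof.
move=> mF; elim: r => [|i r IH].
  rewrite (_ : (fun _ => _) = cst 0); first exact: measurable_cst.
  by apply/funext => x; rewrite big_nil.
rewrite (_ : (fun _ => _) = fun x =>
   if P i then Num.max (F i x) (\big[Num.max/0]_(j <- r | P j) F j x)
   else \big[Num.max/0]_(j <- r | P j) F j x); last first.
  by apply/funext => x; rewrite big_cons.
by case: (boolP (P i)) => Pi //; apply: measurable_maxr => //; exact: mF.
Qed.

Lemma measurable_Vnorm_fin K (s : R -> nat -> R[i]) :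
  (forall n, (0 < n)%N -> in_L2 (s^~ n)) ->
  measurable_fun T01 (fun x => Vnorm_fin 2 K (s x)).
Proof.
move=> sL; apply: measurable_bigmax => P _.
apply: (measurableT_comp (measurable_powR _)).
rewrite (_ : (fun x => _) = fun x =>
    \sum_(I <- enum P) nrm (\sum_(k in I) s x k.+1) `^ 2); last first.
  by apply/funext => x; rewrite big_enum.
apply: measurable_sum => I; apply: (measurableT_comp (measurable_powR _)).
have [mr mi _] : in_L2 (fun x => \sum_(k in I) s x k.+1).
  by apply: (in_L2_sum _ (F := fun (k : 'I_K) x => s x k.+1)) => k _; exact: sL.
exact: measurable_nrm.
Qed.

Lemma L2norm_Vnorm_le (s : R -> nat -> R[i]) (c : \bar R) :
  (forall n, (0 < n)%N -> in_L2 (s^~ n)) ->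
  (forall K, (\int[mu]_(x in T01) (Vnorm_fin 2 K (s x) ^+ 2)%:E <= c)%E) ->
  (L2norm (fun x => Vnorm 2 (s x)) <= c `^ 2^-1)%E.
Proof.
move=> sL H; have c0 : (0 <= c)%E.
  by apply: le_trans (H 0%N); apply: integral_ge0 => x _; rewrite lee_fin sqr_ge0.
rewrite L2normE; apply: gt0_ler_poweR; rewrite ?invr_ge0 ?in_itv/= ?leey ?andbT//.
  by apply: integral_ge0 => x _; exact: poweR_ge0.
under eq_integral do rewrite Vnorm_sqr.
have nd x : nondecreasing_seq (fun K => (Vnorm_fin 2 K (s x) ^+ 2)%:E).
  by move=> m n mn; rewrite lee_fin ler_pXn2r ?nnegrE ?Vnorm_fin_ge0// Vnorm_fin_nd.
have mV K : measurable_fun T01 (fun x => (Vnorm_fin 2 K (s x) ^+ 2)%:E).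
  by apply/measurable_EFinP; apply: measurable_funX; exact: measurable_Vnorm_fin.
have pos K x : T01 x -> (0 <= (Vnorm_fin 2 K (s x) ^+ 2)%:E)%E.
  by move=> _; rewrite lee_fin sqr_ge0.
rewrite (monotone_convergence mu measurable_T01 mV pos (fun x _ => nd x)).
apply: lime_le; last exact: nearW.
apply: ereal_nondecreasing_is_cvgn => m n mn.
by apply: (ge0_le_integral mu measurable_T01 (pos m) (mV m) (mV n)) => x _; exact: nd.
Qed.

Lemma orthonormal_seq_shift phi : @ONS R phi -> orthonormal_seq (fun n => phi n.+1).
Proof. by move=> [L2 on]; split=> [n|m n]; [exact: L2|rewrite on// eqSS]. Qed.

(** The common conclusion of both parts: a variation bound with weight [w N] for
sequences supported on [{0, ..., N}] gives a weighted bound for [f]. *)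
Lemma L2Vnorm_le phi f (w : nat -> R) (B : R) (c : \bar R) :
  ONS phi ->
  (forall n, 1 <= w n) -> {homo w : m n / (m <= n)%N >-> m <= n} -> 0 <= B ->
  (forall N al, (forall n, (N < n)%N -> al n = 0) ->
     var2_L2_le (fun n => phi n.+1) al
       (B * w N * \sum_(0 <= n < N.+1) nrm (al n) ^+ 2)) ->
  (forall K, (((12 * B + 6) *
     \sum_(0 <= n < K) w n * nrm (coef phi f n.+1) ^+ 2)%:E <= c)%E) ->
  (L2Vnorm 2 phi f <= c `^ 2^-1)%E.
Proof.
move=> ons w1 wmono B0 BB Hc.
have ons' := orthonormal_seq_shift ons.
apply: L2norm_Vnorm_le => [n n0|K].
  by rewrite /Sseq; apply: in_L2Z; exact: ons.1.
apply: le_trans (Hc K).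
pose al n := if (n < K)%N then coef phi f n.+1 else 0.
have supp n : (K <= n)%N -> al n = 0 by rewrite /al ltnNge => ->.
have [Q [[mQ Q0 iQ] vQ]] := var2_L2_le_glue ons' w1 wmono B0 BB supp.
rewrite (_ : \sum_(0 <= n < K) w n * nrm (coef phi f n.+1) ^+ 2 =
   \sum_(0 <= n < K) w n * nrm (al n) ^+ 2); last first.
  by apply: eq_big_nat => n /andP[_ nK]; rewrite /al nK.
apply: le_trans iQ; apply: ge0_le_integral => //.
- by move=> x _; rewrite lee_fin sqr_ge0.
- apply/measurable_EFinP; apply: measurable_funX; apply: measurable_Vnorm_fin => n n0.
  by rewrite /Sseq; apply: in_L2Z; exact: ons.1.
- exact/measurable_EFinP.
- move=> x Tx; rewrite lee_fin; apply: Vnorm_fin_sqr_le (vQ x Tx) => // n nK.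
  by rewrite /term /al nK.
Qed.

End Variation.

(** * Consequences of a maximal inequality *)

Section Maximal.
Context {R : realType}.
Local Notation mu := (@lebesgue_measure R).
Local Notation T01 := (`[0%R, 1%R]%classic : set R).
Local Notation nrm := (@Normc.normc R).
Local Hint Extern 0 (measurable _) => exact: measurable_T01 : core.

Variable phi : nat -> R -> R[i].
Hypothesis ons : ONS phi.
Local Notation psi := (fun n => phi n.+1).
Let ons' : orthonormal_seq psi := orthonormal_seq_shift ons.

Lemma lincombE N (a : nat -> R[i]) :
  lincomb phi N a = fun x => isum (term psi (fun n => a n.+1) x) 0 N.
Proof. by apply/funext => x; rewrite /lincomb big_add1. Qed.

Lemma coef_lincomb N (a : nat -> R[i]) n :
  coef phi (lincomb phi N a) n.+1 = if (n < N)%N then a n.+1 else 0.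
Proof. by rewrite /coef lincombE (inner_isum ons'). Qed.

Lemma in_L2_lincomb N a : in_L2 (lincomb phi N a).
Proof. by rewrite lincombE; exact: (in_L2_isum ons'). Qed.

Lemma measurable_maximal f : measurable_fun T01 (maximal phi f).
Proof.
pose g n x := (nrm (\sum_(1 <= k < n.+2) Sseq phi f x k))%:E.
rewrite (_ : maximal phi f = fun x => esups (g^~ x) 0).
  apply: measurable_fun_esups => n; apply/measurable_EFinP.
  have [mr mi _] : in_L2 (fun x => \sum_(1 <= k < n.+2) Sseq phi f x k).
    rewrite (_ : (fun x => _) =
        fun x => \sum_(0 <= k < n.+1) Sseq phi f x k.+1); last first.
      by apply/funext => x; rewrite big_add1.
    apply: (in_L2_sum _ (F := fun k x => Sseq phi f x k.+1)) => k _.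
    by apply: in_L2Z; exact: ons'.1.
  exact: measurable_nrm.
apply/funext => x; rewrite /maximal /esups /sdrop; congr ereal_sup.
apply/seteqP; split => y /=.
  by move=> [[//|n] _ <-]; exists n.
by move=> [n _ <-]; exists n.+1.
Qed.

Lemma maximal_ge N (a : nat -> R[i]) x v : (0 < v)%N ->
  ((nrm (isum (term psi (fun n => if (n < N)%N then a n.+1 else 0) x) 0 v))%:E <=
   maximal phi (lincomb phi N a) x)%E.
Proof.
move=> v0; apply: ereal_sup_ubound; exists v => //; congr (_ %:E); congr nrm.
rewrite big_add1 /= /isum; apply: eq_bigr => n _.
by rewrite /Sseq coef_lincomb.
Qed.

Lemma integral_sqr_le_L2norm (h : R -> R) (g : R -> \bar R) :
  measurable_fun T01 h -> measurable_fun T01 g -> (forall x, 0 <= h x) ->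
  (forall x, (h x)%:E <= g x)%E ->
  ((\int[mu]_(x in T01) (h x ^+ 2)%:E) `^ 2^-1 <= L2norm g)%E.
Proof.
move=> mh mg h0 hg; rewrite L2normE.
have i0 : (0 <= \int[mu]_(x in T01) (h x ^+ 2)%:E)%E.
  by apply: integral_ge0 => x _; rewrite lee_fin sqr_ge0.
have i1 : (\int[mu]_(x in T01) (h x ^+ 2)%:E <= \int[mu]_(x in T01) (`|g x| `^ 2))%E.
  apply: ge0_le_integral => //.
  - by move=> x _; rewrite lee_fin sqr_ge0.
  - by apply/measurable_EFinP; exact: measurable_funX.
  - apply: (measurableT_comp (measurable_poweR _)).
    exact: (measurableT_comp (@abse_measurable _ _)).
  - move=> x _; rewrite -sqr_poweR; apply: gt0_ler_poweR;
      rewrite ?in_itv/= ?leey ?andbT ?abse_ge0//.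
    have hx0 : (0 <= (h x)%:E)%E by rewrite lee_fin.
    by rewrite -abse_EFin !gee0_abs ?(le_trans hx0 (hg x)) ?hg.
apply: gt0_ler_poweR; rewrite ?invr_ge0 ?in_itv/= ?leey ?andbT//.
exact: le_trans i1.
Qed.

Lemma sqrt_poweR (E : R) : 0 <= E -> ((E%:E) `^ 2^-1 = (Num.sqrt E)%:E)%E.
Proof. by move=> E0; rewrite poweR_EFin powR12_sqrt. Qed.

Lemma poweR_half_le (x : \bar R) (y : R) : (0 <= x)%E -> 0 <= y ->
  (x `^ 2^-1 <= y%:E)%E -> (x <= (y ^+ 2)%:E)%E.
Proof.
move=> x0 y0 xy.
have -> : x = ((x `^ 2^-1) `^ 2)%E by rewrite -poweRrM mulVf ?pnatr_eq0// poweRe1.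
rewrite -powR_mulrn// -poweR_EFin; apply: gt0_ler_poweR => //;
  by rewrite in_itv/= ?leey ?andbT ?poweR_ge0 ?lee_fin.
Qed.

Variables (A : R) (Delta : nat -> R).
Hypothesis maxH : forall (N : nat) (a : nat -> R[i]), (0 < N)%N ->
  (L2norm (maximal phi (lincomb phi N a)) <=
   (A * Delta N)%:E * L2normC (lincomb phi N a))%E.

Lemma L2normC_isum al i j :
  L2normC (fun x => isum (term psi al x) i j) =
  (Num.sqrt (\sum_(i <= n < j) nrm (al n) ^+ 2))%:E.
Proof.
rewrite L2normCE -sqrt_poweR; last by apply: sumr_ge0 => n _; exact: sqr_ge0.
by congr (_ `^ _)%E; rewrite -(integral_osc ons').
Qed.

(** The maximal inequality is tested on the first function of the system. *)
Lemma Delta_ge1 N : (0 < N)%N -> 1 <= A * Delta N.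
Proof.
move=> N0; pose e (n : nat) : R[i] := (n == 1%N)%:R.
have n1 : L2normC (lincomb phi N e) = 1%E.
  rewrite lincombE L2normC_isum -(prednK N0) big_nat_recl//= big1.
    by rewrite addr0 !expr0n !expr1n addr0 sqrtr1 expr1n sqrtr1.
  by move=> n _; rewrite !expr0n addr0 sqrtr0 expr0n.
have := maxH e N0; rewrite n1 mule1; rewrite -lee_fin; apply: le_trans.
rewrite -n1 L2normCE.
have [mr mi _] := in_L2_lincomb N e.
apply: integral_sqr_le_L2norm.
- exact: measurable_nrm.
- exact: measurable_maximal.
- by move=> x; exact: normc_ge0.
- move=> x; rewrite [X in nrm (X x)]lincombE; apply: le_trans (maximal_ge N e x N0).
  rewrite lee_fin le_eqVlt; apply/orP; left; apply/eqP; congr nrm.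
  by apply: eq_big_nat => n /andP[_ nN]; rewrite /term nN.
Qed.

(** The largest nondecreasing minorant of [A * Delta] on the positive integers, up
to the shift of index: [N] here stands for the index [N.+1] of [Delta]. *)
Definition lower_Delta N := inf [set A * Delta M | M in [set M | (N < M)%N]].

Lemma lower_Delta_lb N : lbound [set A * Delta M | M in [set M | (N < M)%N]] 1.
Proof. by move=> _ [M /= NM <-]; apply: Delta_ge1; exact: leq_trans NM. Qed.

Lemma lower_Delta_le N M : (N < M)%N -> lower_Delta N <= A * Delta M.
Proof. by move=> NM; apply: ge_inf; [exists 1; exact: lower_Delta_lb|exists M]. Qed.

Lemma le_lower_Delta N c :
  (forall M, (N < M)%N -> c <= A * Delta M) -> c <= lower_Delta N.
Proof.
move=> h; apply: lb_le_inf; first by exists (A * Delta N.+1), N.+1 => /=.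
by move=> _ [M /= NM <-]; exact: h.
Qed.

Lemma lower_Delta_ge1 N : 1 <= lower_Delta N.
Proof. by apply: le_lower_Delta => M NM; apply: Delta_ge1; exact: leq_trans NM. Qed.

Lemma lower_Delta_mono : {homo lower_Delta : m n / (m <= n)%N >-> m <= n}.
Proof.
move=> m n mn; apply: le_lower_Delta => M nM; apply: lower_Delta_le.
exact: leq_ltn_trans nM.
Qed.

(** Restricted to a dyadic interval, the series is a linear combination of length
[M] for every [M > N], and its prefix sums are those of the restriction. *)
Lemma int_le_prefix_max N al k u : (forall n, (N < n)%N -> al n = 0) ->
  int_le (fun x => prefix_max (term psi al x) k u ^+ 2)
    (lower_Delta N ^+ 2 * \sum_(u <= n < u + 2 ^ k) nrm (al n) ^+ 2).
Proof.
move=> supp; set E := \sum_(_ <= _ < _) _.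
have E0 : 0 <= E by apply: sumr_ge0 => n _; exact: sqr_ge0.
have mp : measurable_fun T01 (fun x => prefix_max (term psi al x) k u).
  apply: measurable_bigmax => v _.
  by have [mr mi _] := in_L2_isum ons' al u (u + v); exact: measurable_nrm.
split; [exact: measurable_funX|by move=> x; exact: sqr_ge0|].
(* The coefficients restricted to the dyadic interval. *)
pose alJ n := if (u <= n < u + 2 ^ k)%N then al n else 0.
pose a n := alJ n.-1.
have suppJ n : (N < n)%N -> alJ n = 0.
  by move=> Nn; rewrite /alJ supp ?if_same.
have trunc x v : (v <= 2 ^ k)%N ->
    isum (term psi alJ x) 0 (u + v) = isum (term psi al x) u (u + v).
  move=> vk; rewrite (@isum_cat _ _ 0 u) ?leq_addr//.
  rewrite [X in X + _]isum0 ?add0r => [|n /andP[_ nu]].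
    apply: eq_big_nat => n /andP[un nv]; rewrite /term /alJ un /=.
    by rewrite (leq_trans nv)// leq_add2l.
  by rewrite /term /alJ leqNgt nu mul0r.
have fM M : (N < M)%N -> lincomb phi M a = fun x => isum (term psi al x) u (u + 2 ^ k).
  move=> NM; rewrite lincombE; apply/funext => x.
  rewrite -trunc// /a /=.
  have z K : (K <= N + M + (u + 2 ^ k))%N -> (N < K)%N || (u + 2 ^ k <= K)%N ->
      isum (term psi alJ x) 0 K = isum (term psi alJ x) 0 (N + M + (u + 2 ^ k)).
    move=> KL h; rewrite [RHS](@isum_cat _ _ 0 K)//.
    rewrite [X in _ + X]isum0 ?addr0// => n /andP[Kn _]; rewrite /term.
    have -> : alJ n = 0; last by rewrite mul0r.
    case/orP: h => h; first by apply: suppJ; exact: leq_trans Kn.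
    by rewrite /alJ [(n < _)%N]ltnNge (leq_trans h Kn) andbF.
  by rewrite z ?[RHS]z//; lia.
have L M : (N < M)%N ->
    ((\int[mu]_(x in T01) (prefix_max (term psi al x) k u ^+ 2)%:E) `^ 2^-1 <=
     (A * Delta M * Num.sqrt E)%:E)%E.
  move=> NM; rewrite EFinM -L2normC_isum -(fM _ NM).
  apply: le_trans (maxH a (leq_ltn_trans (leq0n _) NM)).
  apply: integral_sqr_le_L2norm => //.
  - exact: measurable_maximal.
  - by move=> x; exact: prefix_max_ge0.
  - move=> x.
    have ge v : (0 < v)%N -> ((nrm (isum (term psi alJ x) 0 v))%:E <=
        maximal phi (lincomb phi M a) x)%E.
      move=> v0; apply: le_trans (maximal_ge M a x v0).
      rewrite lee_fin le_eqVlt; apply/orP; left; apply/eqP; congr nrm.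
      apply: eq_bigr => n _; rewrite /term; case: ltnP => // Mn.
      by rewrite suppJ// (leq_trans NM).
    have g0 : (0 <= maximal phi (lincomb phi M a) x)%E.
      by apply: le_trans (ge 1%N isT); rewrite lee_fin normc_ge0.
    rewrite /prefix_max; elim/big_ind: _ => [//|y z hy hz|v _].
      by rewrite EFin_max ge_max hy hz.
    rewrite -trunc; last by rewrite -ltnS.
    have [->|v0] := posnP (u + v); last exact: ge.
    by rewrite /isum big_geq// normc_zero.
rewrite (_ : lower_Delta N ^+ 2 * E = (lower_Delta N * Num.sqrt E) ^+ 2); last first.
  by rewrite exprMn sqr_sqrtr.
have D0 : 0 <= lower_Delta N by rewrite (le_trans _ (lower_Delta_ge1 N)).
have i0 : (0 <= \int[mu]_(x in T01) (prefix_max (term psi al x) k u ^+ 2)%:E)%E.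
  by apply: integral_ge0 => x _; rewrite lee_fin sqr_ge0.
apply: poweR_half_le; rewrite ?mulr_ge0 ?sqrtr_ge0//.
move: (poweR_ge0 (\int[mu]_(x in T01) (prefix_max (term psi al x) k u ^+ 2)%:E) 2^-1) L.
case: (poweR _ _) => [r||//] _ L; last by have := L _ (ltnSn N).
rewrite lee_fin; have := sqrtr_ge0 E; rewrite le_eqVlt => /orP[/eqP s0|s0].
  by have := L _ (ltnSn N); rewrite lee_fin -s0 !mulr0.
rewrite -ler_pdivrMr//; apply: le_lower_Delta => M NM.
by rewrite ler_pdivrMr// -lee_fin L.
Qed.

End Maximal.

(** * The square variation of orthonormal series *)

Theorem theorem3 (R : realType) :
  (exists C : R, 0 < C /\
     forall (phi : nat -> R -> R[i]) (f : R -> R[i]),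
       ONS phi -> in_L2 f ->
       (L2Vnorm 2 phi f <=
        C%:E * (\sum_(1 <= n <oo)
                  ((Normc.normc (coef phi f n)) ^+ 2 *
                   (ln (n.+1%:R)) ^+ 2)%:E) `^ (2^-1))%E)
  /\
  (forall A : R, 0 < A ->
     exists C' : R, 0 < C' /\
       forall (phi : nat -> R -> R[i]) (Delta : nat -> R),
         ONS phi ->
         (forall (N : nat) (a : nat -> R[i]), (0 < N)%N ->
            (L2norm (maximal phi (lincomb phi N a)) <=
             (A * Delta N)%:E * L2normC (lincomb phi N a))%E) ->
         forall (N : nat) (a : nat -> R[i]), (0 < N)%N ->
           (L2Vnorm 2 phi (lincomb phi N a) <=
            (C' * Num.sqrt (\sum_(1 <= n < N.+1)
                   (Delta n) ^+ 2 * ln (n.+1%:R) *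
                   (Normc.normc (a n)) ^+ 2))%:E)%E).
Proof.
have l2 : 0 < ln 2 :> R by rewrite ln_gt0// ltr1n.
(* [b] compares [dlevel n] with [ln (n + 2)]. *)
set b : R := 2 / ln 2.
have b0 : 0 < b by rewrite divr_gt0.
have dl1 n : 1 <= (dlevel n)%:R :> R by rewrite ler1n.
have dlm : {homo (fun n => (dlevel n)%:R : R) : m n / (m <= n)%N >-> m <= n}.
  by move=> m n mn; rewrite ler_nat dlevel_mono.
have lnp n : 0 <= ln n.+2%:R :> R by rewrite ln_ge0// ler1n.
split.
  (* The factor [12 * B + 6] of the gluing, with the block constant [B = 6]. *)
  pose C2 : R := (12 * 6 + 6) * b ^+ 2.
  have C20 : 0 < C2 by rewrite mulr_gt0 ?exprn_gt0.
  exists (Num.sqrt C2); split; first by rewrite sqrtr_gt0.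
  move=> phi f ons fL; set S := (\sum_(1 <= n <oo) _)%E.
  have S0 : (0 <= S)%E.
    by apply: nneseries_ge0 => n _ _; rewrite lee_fin mulr_ge0 ?sqr_ge0.
  rewrite -sqrt_poweR ?(ltW C20)// -poweRM// ?lee_fin ?(ltW C20)//.
  apply: (@L2Vnorm_le _ phi f (fun n => (dlevel n)%:R ^+ 2) 6) => //.
  - by move=> n; rewrite exprn_ege1.
  - by move=> m n mn; rewrite ler_pXn2r ?nnegrE ?ler0n ?dlm.
  - by move=> N al supp; exact: var2_L2_le_log (orthonormal_seq_shift ons) supp.
  - move=> K; apply: (@le_trans _ _ (C2%:E *
      \sum_(1 <= n < K.+1) (Normc.normc (coef phi f n) ^+ 2 * ln n.+1%:R ^+ 2)%:E)%E).
      rewrite sumEFin -EFinM lee_fin /C2 -[leRHS]mulrA ler_wpM2l//.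
      rewrite big_add1 succnK mulr_sumr; apply: ler_sum => n _.
      rewrite [Normc.normc _ ^+ 2 * _]mulrC [b ^+ 2 * _]mulrA.
      rewrite -[b ^+ 2 * _ ^+ 2]exprMn ler_wpM2r ?sqr_ge0//.
      by rewrite ler_pXn2r ?nnegrE ?ler0n ?mulr_ge0 ?invr_ge0 ?(ltW l2)//; exact: dlevel_ln.
    apply: lee_wpmul2l; first by rewrite lee_fin ltW.
    by apply: nneseries_lim_ge => n _; rewrite lee_fin mulr_ge0 ?sqr_ge0.
move=> A A0.
(* Now the block constant is [B = 8]. *)
pose C2 : R := (12 * 8 + 6) * (A ^+ 2 * b).
have C20 : 0 < C2 by rewrite mulr_gt0 ?mulr_gt0 ?exprn_gt0 ?invr_gt0.
exists (Num.sqrt C2); split; first by rewrite sqrtr_gt0.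
move=> phi Delta ons maxH N a N0; set S := \sum_(1 <= n < N.+1) _.
have S0 : 0 <= S.
  rewrite /S big_add1; apply: sumr_ge0 => n _.
  by rewrite mulr_ge0 ?sqr_ge0// mulr_ge0 ?sqr_ge0.
rewrite -sqrtrM ?(ltW C20)// -sqrt_poweR; last by rewrite mulr_ge0 ?(ltW C20).
pose D := lower_Delta A Delta.
have D1 n : 1 <= D n := lower_Delta_ge1 ons maxH n.
have Dp n : 0 <= D n by apply: le_trans (D1 n).
have Dm : {homo D : m n / (m <= n)%N >-> m <= n} := lower_Delta_mono ons maxH.
apply: (@L2Vnorm_le _ phi _ (fun n => D n ^+ 2 * (dlevel n)%:R) 8) => //.
- by move=> n; rewrite mulr_ege1 ?exprn_ege1.
- by move=> m n mn; rewrite ler_pM ?sqr_ge0 ?ler0n ?dlm// ler_pXn2r ?nnegrE// Dm.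
- move=> M al supp; apply: var2_L2_le_max => //; first exact: sqr_ge0.
  by move=> k u; exact: int_le_prefix_max.
- move=> K; rewrite lee_fin /C2 -[leRHS]mulrA ler_wpM2l//.
  apply: (@le_trans _ _ (\sum_(0 <= n < N)
    (A * Delta n.+1) ^+ 2 * (b * ln n.+2%:R) * Normc.normc (a n.+1) ^+ 2)).
    pose F n : R := if (n < N)%N then
      D n ^+ 2 * (dlevel n)%:R * Normc.normc (a n.+1) ^+ 2 else 0.
    have F0 n : 0 <= F n.
      by rewrite /F; case: ifP => // _; rewrite mulr_ge0 ?sqr_ge0// mulr_ge0 ?sqr_ge0.
    rewrite (eq_bigr F) => [|n _]; last first.
      by rewrite coef_lincomb// /F; case: ifP => // _; rewrite normc_zero expr0n mulr0.
    apply: (@le_trans _ _ (\sum_(0 <= n < N) F n)).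
      have [KN|/ltnW NK] := leqP K N.
        by rewrite [leRHS](big_cat_nat (leq0n K) KN)/= lerDl; exact: sumr_ge0.
      rewrite (big_cat_nat (leq0n N) NK)/= [X in _ + X]big_nat [X in _ + X]big1 ?addr0//.
      by move=> n /andP[Nn _]; rewrite /F ltnNge Nn.
    apply: ler_sum_nat => n /andP[_ nN]; rewrite /F nN.
    rewrite ler_wpM2r ?sqr_ge0//; apply: ler_pM; rewrite ?sqr_ge0//.
      have DD : D n <= A * Delta n.+1 by exact: (lower_Delta_le ons maxH (ltnSn n)).
      by rewrite ler_pXn2r ?nnegrE// (le_trans (Dp n)).
    exact: dlevel_ln.
  rewrite /S big_add1 /= mulr_sumr le_eqVlt; apply/orP; left; apply/eqP.
  by apply: eq_bigr => n _; rewrite exprMn; ring.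
Qed.
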